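(* For each $\nu\in\Lambda_G$ (viewed as an element of $\mathfrak a_G$), the set $$X_\nu=\{c\in\mathbb{A}(F)_\nu:\ \exists\,a\in A(\overline F)\text{ with } c=c(a)\text{ and }\mathrm{val}\,\Omega(a)=m_\nu\}$$ is non-empty, and for any $a\in A(\overline F)$ with $c(a)\in X_\nu$, any element $h\in W$ with $\sigma(a)=h(a)$ is conjugate in $W$ to $\psi_G(\nu)$.
   Context: Let $G$ be a connected reductive group over $\mathbb{C}$ of rank $n$ whose derived group $G_{sc}$ is simply connected, of rank $l$. Fix a maximal torus $A$ and a Borel subgroup $B\supseteq A$; $A_{sc}=A\cap G_{sc}$. $R\subset X^*(A)$ are the roots, $\{\alpha_i\}_{i\in I}$, $I=\{1,\dots,l\}$, the simple roots for $B$; $Q(R),Q(R^\vee)$ root and coroot lattices, $P(R),P(R^\vee)$ the dual lattices (so $X_*(A_{sc})=Q(R^\vee)$), $\varpi_i$ the fundamental weights. Choose a $\mathbb{Z}$-basis $\omega_1,\dots,\omega_n$ of $X^*(A)$ with $\omega_i|_{A_{sc}}=\varpi_i$ for $i\le l$ and $\omega_{l+1},\dots,\omega_n$ a basis of the kernel of restriction. $W$ is the Weyl group, $c_i=\sum_{\lambda\in W\omega_i}e^\lambda$, $\mathbb{A}=\mathbb{G}_a^l\times\mathbb{G}_m^{n-l}$, $c=(c_1,\dots,c_n):A\to\mathbb{A}$. $\Omega=\prod_{\alpha\in R}(1-e^\alpha)$, $m_\nu=\sum_{\alpha\in R}\max\{0,\langle\alpha,\nu\rangle\}$ (which is $0$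 for $\nu\in\Lambda_G$). $F=\mathbb{C}((\epsilon))$, $\overline F=\bigcup_n\mathbb{C}((\epsilon^{1/n}))$ with compatible roots, $\sigma$ the Galois generator with $\sigma(\epsilon^{1/n})=e^{2\pi\sqrt{-1}/n}\epsilon^{1/n}$, $\mathrm{val}$ the valuation with $\mathrm{val}(\epsilon^{1/n})=-1/n$. $\mathfrak a=X_*(A)\otimes\mathbb{R}$; $A_G$ is the identity component of the center of $G$, $\mathfrak a_G=X_*(A_G)\otimes\mathbb{R}=\mathfrak a^W$, $p_G:\mathfrak a\to\mathfrak a_G$ the $W$-average, and $\Lambda_G=X_*(A)/X_*(A_{sc})$, identified with $p_G(X_*(A))\subset\mathfrak a_G$. For $\nu\in\Lambda_G$, $\mathbb{A}(F)_\nu$ is the set of $c\in\mathbb{A}(\overline F)$ for which there is $a\in A(\overline F)$ with $c=c(a)$, $\sigma(a)=g(a)$ for some $g\in W$, and $\langle\lambda,\nu\rangle=\mathrm{val}\,\lambda(a)$ for all $\lambda\in X^*(A)$. $\psi$: for a reduced irreducible root system $R$ with basis $\{\alpha_i\}$, highest root $\tilde\alpha$, let $W_e=P(R^\vee)\rtimes W$ act on $V^*$ ($V=Q(R)\otimes\mathbb{R}$), $P(R^\vee)$ by translations; $C=\{v:\langle\alpha_i,v\rangle>0\ \forall i,\ \langle\tilde\alpha,v\rangle<1\}$; the stabilizer $\Gamma_C$ of $C$ in $W_e$ maps isomorphically ($\xi$) onto $W_e/(Q(R^\vee)\rtimes W)\cong P(R^\vee)/Q(R^\vee)$, and $\psi=\mathrm{pr}\circ\xi^{-1}$,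 $\mathrm{pr}:W_e\to W$; for reducible $R$ take the product over components. $\psi_G$ is the composite of $\Lambda_G\to P(R^\vee)/Q(R^\vee)$ (induced by $\lambda\mapsto\langle\cdot,\lambda\rangle|_{Q(R)}$, i.e. $\Lambda_G\twoheadrightarrow\Lambda_G/X_*(A_G)\hookrightarrow P(R^\vee)/Q(R^\vee)$) with $\psi$. *)

(* Defs.v *)
From HB Require Import structures.
From mathcomp Require Import all_boot all_order all_algebra.
From mathcomp Require Import boolp classical_sets functions fsbigop reals.
From mathcomp Require Import trigo.
From mathcomp Require Import complex.

Set Implicit Arguments.
Unset Strict Implicit.
Unset Printing Implicit Defensive.

Import Order.TTheory GRing.Theory Num.Theory.
Local Open Scope classical_set_scope.
Local Open Scope ring_scope.

(* X^*(A) = Z^n with the basis omega_1..omega_n = standard basis vectors      *)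
(* (characters are integer column vectors); X_*(A) = Z^n in the dual basis.  *)

Definition evec (n : nat) (i : nat) : 'cV[int]_n :=
  \col_(k < n) ((k : nat) == i)%:R.

Definition pairZ n (lam x : 'cV[int]_n) : int := \sum_(k < n) lam k 0 * x k 0.
Definition pairQ n (lam : 'cV[int]_n) (x : 'cV[rat]_n) : rat :=
  \sum_(k < n) (lam k 0)%:~R * x k 0.
Definition pairR (R : realType) n (lam : 'cV[int]_n) (x : 'cV[R]_n) : R :=
  \sum_(k < n) (lam k 0)%:~R * x k 0.

Definition refl n (al alv : 'cV[int]_n) : 'M[int]_n := 1%:M - al *m alv^T.
Definition crefl n (al alv : 'cV[int]_n) : 'M[int]_n := 1%:M - alv *m al^T.

Definition simple_comb n l (simple : 'I_l -> 'cV[int]_n) (c : 'I_l -> int) :=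
  \sum_(i < l) c i *: simple i.

(* Hypotheses: (roots, coroot) is a reduced root datum on (Z^n, Z^n);
   simple is a basis of the root system; the coroot of the i-th simple root
   is the i-th dual basis vector, i.e. <omega_j, alpha_i^v> = delta_ij for all
   j (this encodes the choice of the basis omega, which exists exactly because
   the derived group is simply connected). *)
Definition root_datum_hyp n l (roots : seq 'cV[int]_n)
    (coroot : 'cV[int]_n -> 'cV[int]_n) (simple : 'I_l -> 'cV[int]_n) : Prop :=
  uniq roots /\
  uniq (map coroot roots) /\
  (forall al, al \in roots -> pairZ al (coroot al) = 2) /\
  (forall al be, al \in roots -> be \in roots ->
      refl al (coroot al) *m be \in roots) /\
  (forall al be, al \in roots -> be \in roots ->
      crefl al (coroot al) *m coroot be \in map coroot roots) /\
  (forall al be (a b : int), al \in roots -> be \in roots -> a != 0 ->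
      a *: be = b *: al -> be = al \/ be = - al) /\
  (forall i, simple i \in roots) /\
  (forall c, simple_comb simple c = 0 -> forall i, c i = 0) /\
  (forall al, al \in roots -> exists c, al = simple_comb simple c /\
      ((forall i, 0 <= c i) \/ (forall i, c i <= 0))) /\
  (forall i : 'I_l, coroot (simple i) = evec n i).

(* Weyl group, as the group of matrices acting on X^*(A) (lam |-> w *m lam)
   generated by the reflections s_alpha *)
Definition weyl n (roots : seq 'cV[int]_n) (coroot : 'cV[int]_n -> 'cV[int]_n)
  : set 'M[int]_n :=
  [set M | exists s : seq 'cV[int]_n, all (mem roots) s /\
           M = foldr (fun al N => refl al (coroot al) *m N) 1%:M s].

Definition weyl_conj n roots coroot (h w : 'M[int]_n) : Prop :=
  exists u, weyl roots coroot u /\ u *m w = h *m u.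

(* contragredient action of w on X_*(A) (x) R and on X_*(A) (x) Q *)
Definition dualR (R : realType) n (w : 'M[int]_n) : 'M[R]_n :=
  invmx (map_mx (fun z : int => z%:~R : R) w)^T.
Definition dualQ n (w : 'M[int]_n) : 'M[rat]_n :=
  invmx (map_mx (fun z : int => z%:~R : rat) w)^T.

(* p_G : a -> a_G, the W-average (on rational points) *)
Definition pG n roots coroot (nu : 'cV[int]_n) : 'cV[rat]_n :=
  (\sum_(M \in weyl roots coroot) (1 : rat))^-1 *:
  \sum_(M \in weyl roots coroot) (dualQ M *m map_mx (fun z : int => z%:~R : rat) nu).

Definition m_nu n roots coroot (nu : 'cV[int]_n) : rat :=
  \sum_(al <- roots) Num.max 0 (pairQ al (pG roots coroot nu)).

Definition dom_le n l (simple : 'I_l -> 'cV[int]_n) (be ga : 'cV[int]_n) :=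
  exists c, ga - be = simple_comb simple c /\ forall i, 0 <= c i.
Definition posroot n l (roots : seq 'cV[int]_n) (simple : 'I_l -> 'cV[int]_n) al :=
  al \in roots /\ dom_le simple 0 al.
(* highest roots: the maximal positive roots (one per irreducible component) *)
Definition highest_root n l roots (simple : 'I_l -> 'cV[int]_n) be :=
  posroot roots simple be /\
  forall ga, posroot roots simple ga -> dom_le simple be ga -> ga = be.

(* the (preimage in a = X_*(A) (x) R of the) fundamental alcove C of V^*:
   <alpha_i, v> > 0 for all i, <highest root, v> < 1 for each component *)
Definition alcove (R : realType) n l roots (simple : 'I_l -> 'cV[int]_n)
  : set 'cV[R]_n :=
  [set x | (forall i, 0 < pairR (simple i) x) /\
           forall be, highest_root roots simple be -> pairR be x < 1].

(* w = psi_G(nu):  (t, w) lies in the stabilizer Gamma_C of the alcove in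
   W_e = P(R^v) x| W, for some translation t in the class of nu in
   P(R^v)/Q(R^v), i.e. t = nu + q with q in Q(R^v). *)
Definition is_psiG (R : realType) n l roots coroot (simple : 'I_l -> 'cV[int]_n)
    (nu : 'cV[int]_n) (w : 'M[int]_n) : Prop :=
  weyl roots coroot w /\
  exists c : 'I_l -> int,
    let t := map_mx (fun z : int => z%:~R : R)
               (nu + \sum_(i < l) c i *: coroot (simple i)) in
    (fun x => @dualR R n w *m x + t) @` @alcove R n l roots simple
    = @alcove R n l roots simple.

(* Puiseux series  Fbar = U_N C((eps^(1/N))),  C = R[i]                       *)
(* a series is the function q |-> coefficient of eps^q                        *)
Definition puis (R : realType) := rat -> R[i].

Definition is_puis (R : realType) (f : puis R) : Prop :=
  exists N : nat, (0 < N)%N /\ exists m : int,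
    forall q, f q != 0 -> exists k : int, q = k%:~R / N%:R /\ m <= k.

Definition pone (R : realType) : puis R := fun q => if q == 0 then 1 else 0.
Definition psub (R : realType) (f g : puis R) : puis R := fun q => f q - g q.
Definition pmul (R : realType) (f g : puis R) : puis R :=
  fun q => \sum_(r \in [set: rat]) f r * g (q - r).

(* sigma(eps^(1/N)) = exp(2 pi i/N) eps^(1/N) *)
Definition expi (R : realType) (t : R) : R[i] := Complex (cos t) (sin t).
Definition psigma (R : realType) (f : puis R) : puis R :=
  fun q => expi (2 * pi * ratr q) * f q.

(* val f = v  (val(eps^(1/N)) = -1/N) *)
Definition has_val (R : realType) (f : puis R) (v : rat) : Prop :=
  f (- v) != 0 /\ forall q, f q != 0 -> - v <= q.

(* The torus A(Fbar) = Hom(X^*(A), Fbar^x), a |-> (lam |-> lam(a))            *)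
Definition is_torus_pt (R : realType) n (a : 'cV[int]_n -> puis R) : Prop :=
  (forall lam, is_puis (a lam)) /\
  (forall lam, a lam != (fun _ => 0)) /\
  a 0 = pone R /\
  (forall lam mu, a (lam + mu) = pmul (a lam) (a mu)).

(* Galois action and Weyl action:  lam(g(a)) = (g^-1 lam)(a) *)
Definition tsigma (R : realType) n (a : 'cV[int]_n -> puis R) :=
  fun lam => psigma (a lam).
Definition tweyl (R : realType) n (g : 'M[int]_n) (a : 'cV[int]_n -> puis R) :=
  fun lam => a (invmx g *m lam).

Definition cmap (R : realType) n roots coroot (a : 'cV[int]_n -> puis R)
  : 'I_n -> puis R :=
  fun i q => \sum_(lam \in [set M *m evec n i | M in weyl roots coroot]) a lam q.

Definition Omega (R : realType) n (roots : seq 'cV[int]_n)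
  (a : 'cV[int]_n -> puis R) : puis R :=
  foldr (fun al acc => pmul (psub (pone R) (a al)) acc) (pone R) roots.

(* AA(F)_nu, nu viewed in a_G as p_G(nu) *)
Definition AF_nu (R : realType) n roots coroot (nu : 'cV[int]_n)
    (c : 'I_n -> puis R) : Prop :=
  exists a, is_torus_pt a /\ c = cmap roots coroot a /\
    (exists g, weyl roots coroot g /\ tsigma a = tweyl g a) /\
    forall lam, has_val (a lam) (pairQ lam (pG roots coroot nu)).

Definition X_nu (R : realType) n roots coroot (nu : 'cV[int]_n)
    (c : 'I_n -> puis R) : Prop :=
  AF_nu roots coroot nu c /\
  exists a, is_torus_pt a /\ c = cmap roots coroot a /\
    has_val (Omega roots a) (m_nu roots coroot nu).

(* Main.v *)
Require Import Defs.
From HB Require Import structures.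
From mathcomp Require Import all_boot all_order all_algebra.
From mathcomp Require Import boolp classical_sets functions cardinality fsbigop reals.
From mathcomp Require Import sequences exp trigo.
From mathcomp Require Import complex.
From mathcomp Require Import zify ring lra.
Set Implicit Arguments.
Unset Strict Implicit.
Unset Printing Implicit Defensive.
Import Order.TTheory GRing.Theory Num.Theory.
Local Open Scope classical_set_scope.
Local Open Scope ring_scope.

(* The map c separates W-orbits on the torus: the W-symmetrized characters
   S(lam) are determined by the S(omega_i), by induction on the height of a
   dominant lam through S(lam) S(mu) = sum_w S(lam + w mu), and two points with
   the same S are W-conjugate by independence of characters. So in the second
   assertion a may be replaced by a conjugate with valuation vector p_G(nu),
   on which val Omega = 0 says that the leading coefficients t(al) differ
   from 1 for all roots al. Writing t in terms of modulus and argument, the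
   argument, slightly moved along the log-modulus, becomes a regular point y of
   the real apartment which h fixes up to translation by an element of the
   class of nu. The affine Weyl group moves y into the alcove, hence conjugates
   h to psi_G(nu). For the first assertion, the affine transformation attached
   to psi_G(nu) has finite order on the alcove and so fixes the barycenter x of
   an orbit; exp(- 2 i pi x) eps^(- p_G(nu)) is the required point. *)

(** * Root data with coroots dual to a basis *)

(** The basis dual to the simple coroots makes classes visible: every coroot vanishes in the
    coordinates from l on, W fixes these coordinates of a cocharacter, and two cocharacters have the
    same class in Lambda_G exactly when these coordinates agree. The class of nu is tracked in this
    form throughout. The affine arguments take place in a itself, not modulo a_G. The alcove is
    stable under a_G, so an affine map preserving it fixes a point only up to a vector of a_G, and
    this vector turns out to be p_G(nu). The argument has to be moved because t(al) <> 1 keeps it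
    off the walls of al only when the log-modulus vanishes on al. The Galois action alters arguments
    only, so h fixes the log-modulus; a small move along it preserves the relation satisfied by h
    and leaves the remaining walls. *)

Lemma map_perm_self (T : eqType) (f : T -> T) (s : seq T) :
  uniq s -> injective f -> (forall x, x \in s -> f x \in s) ->
  perm_eq (map f s) s.
Proof.
move=> us inj_f fs.
have um : uniq (map f s) by rewrite map_inj_uniq.
apply: uniq_perm => //; apply: (uniq_min_size um _ _).2; last by rewrite size_map.
by move=> _ /mapP[x xs ->]; apply: fs.
Qed.

Section Pairing.
Variable n : nat.
Implicit Types (lam mu x y al alv : 'cV[int]_n) (M : 'M[int]_n).

Lemma pairZE lam x : pairZ lam x = (lam^T *m x) 0 0.
Proof. by rewrite mxE; apply: eq_bigr => k _; rewrite mxE. Qed.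

Lemma pairZC lam x : pairZ lam x = pairZ x lam.
Proof. by apply: eq_bigr => k _; rewrite mulrC. Qed.

Lemma pairZ_mull M lam x : pairZ (M *m lam) x = pairZ lam (M^T *m x).
Proof. by rewrite !pairZE trmx_mul mulmxA. Qed.

Lemma pairZDl lam mu x : pairZ (lam + mu) x = pairZ lam x + pairZ mu x.
Proof. by rewrite !pairZE linearD mulmxDl mxE. Qed.

Lemma pairZZl c lam x : pairZ (c *: lam) x = c * pairZ lam x.
Proof. by rewrite !pairZE linearZ -scalemxAl mxE. Qed.

Lemma pairZDr lam x y : pairZ lam (x + y) = pairZ lam x + pairZ lam y.
Proof. by rewrite !(pairZC lam) pairZDl. Qed.

Lemma pairZZr c lam x : pairZ lam (c *: x) = c * pairZ lam x.
Proof. by rewrite !(pairZC lam) pairZZl. Qed.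

Lemma pairZNl lam x : pairZ (- lam) x = - pairZ lam x.
Proof. by rewrite -scaleN1r pairZZl mulN1r. Qed.

Lemma pairZBl lam mu x : pairZ (lam - mu) x = pairZ lam x - pairZ mu x.
Proof. by rewrite pairZDl pairZNl. Qed.

Lemma pairZ0l x : pairZ 0 x = 0.
Proof. by rewrite -(scale0r 0) pairZZl mul0r. Qed.

Lemma pairZ_suml (I : Type) (r : seq I) (P : pred I) (F : I -> 'cV_n) x :
  pairZ (\sum_(i <- r | P i) F i) x = \sum_(i <- r | P i) pairZ (F i) x.
Proof.
by apply: (big_morph (fun lam => pairZ lam x) _ (pairZ0l x)) => a b; rewrite pairZDl.
Qed.

Lemma pairZ_sumr (I : Type) (r : seq I) (P : pred I) (F : I -> 'cV_n) x :
  pairZ x (\sum_(i <- r | P i) F i) = \sum_(i <- r | P i) pairZ x (F i).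
Proof. by rewrite pairZC pairZ_suml; apply: eq_bigr => i _; rewrite pairZC. Qed.

Lemma pairZ_evec (k : 'I_n) x : pairZ (evec n k) x = x k 0.
Proof.
rewrite /pairZ (bigD1 k) //= mxE eqxx mul1r big1 ?addr0 // => j jk.
by rewrite mxE (inj_eq val_inj) (negbTE jk) mul0r.
Qed.

Lemma pairZ_extr x y : (forall lam, pairZ lam x = pairZ lam y) -> x = y.
Proof.
by move=> exy; apply/matrixP => k j; rewrite ord1 -!pairZ_evec exy.
Qed.

Lemma reflE al alv lam : refl al alv *m lam = lam - pairZ lam alv *: al.
Proof.
rewrite mulmxBl mul1mx -mulmxA pairZC pairZE; congr (_ - _).
by apply/matrixP => i j; rewrite !mxE big_ord1 !ord1 mulrC; congr (_ * _); rewrite mxE.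
Qed.

Lemma crefl_tr (al alv : 'cV[int]_n) : crefl al alv = (refl al alv)^T.
Proof. by rewrite /refl linearB /= trmx1 trmx_mul trmxK. Qed.

Lemma creflE al alv x : crefl al alv *m x = x - pairZ al x *: alv.
Proof. by rewrite [LHS](reflE alv al x) pairZC. Qed.

Lemma refl_sq al alv : pairZ al alv = 2 -> refl al alv *m refl al alv = 1%:M.
Proof.
move=> h; have e : alv^T *m al = 2%:M :> 'M_1.
  apply/matrixP => i j; rewrite !ord1 -[LHS]pairZE pairZC h mxE eqxx.
  by [].
rewrite [X in _ *m X]/refl mulmxBr mulmx1 mulmxA {1}/refl mulmxBl mul1mx.
rewrite -(mulmxA al) e mul_mx_scalar /refl scaler_nat mulr2n mulmxBl mulmxDl.
by rewrite opprB addrC; apply/matrixP=> i j; rewrite !mxE; ring.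
Qed.

End Pairing.

Section RootDatum.
Variables (n l : nat) (roots : seq 'cV[int]_n) (coroot : 'cV[int]_n -> 'cV[int]_n).
Variable simple : 'I_l -> 'cV[int]_n.
Hypothesis hRD : root_datum_hyp roots coroot simple.
Implicit Types (al be lam mu x : 'cV[int]_n) (M N : 'M[int]_n).

Local Notation s al := (refl al (coroot al)).
Local Notation cs al := (crefl al (coroot al)).
Local Notation W := (weyl roots coroot).

Lemma roots_uniq : uniq roots. Proof. by case: hRD. Qed.
Lemma coroots_uniq : uniq (map coroot roots). Proof. by case: hRD => _ []. Qed.
Lemma pair_coroot al : al \in roots -> pairZ al (coroot al) = 2.
Proof. by case: hRD => _ [_ [h _]]; apply: h. Qed.
Lemma refl_root al be : al \in roots -> be \in roots -> s al *m be \in roots.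
Proof. by case: hRD => _ [_ [_ [h _]]]; apply: h. Qed.
Lemma crefl_coroot al be : al \in roots -> be \in roots ->
  cs al *m coroot be \in map coroot roots.
Proof. by case: hRD => _ [_ [_ [_ [h _]]]]; apply: h. Qed.
Lemma roots_reduced al be (a b : int) : al \in roots -> be \in roots -> a != 0 ->
  a *: be = b *: al -> be = al \/ be = - al.
Proof. by case: hRD => _ [_ [_ [_ [_ [h _]]]]]; apply: h. Qed.
Lemma simple_root i : simple i \in roots.
Proof. by case: hRD => _ [_ [_ [_ [_ [_ [h _]]]]]]; apply: h. Qed.
Lemma simple_free c : simple_comb simple c = 0 -> forall i, c i = 0.
Proof. by case: hRD => _ [_ [_ [_ [_ [_ [_ [h _]]]]]]]; apply: h. Qed.
Lemma root_comb al : al \in roots -> exists c, al = simple_comb simple c /\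
  ((forall i, 0 <= c i) \/ (forall i, c i <= 0)).
Proof. by case: hRD => _ [_ [_ [_ [_ [_ [_ [_ [h _]]]]]]]]; apply: h. Qed.
Lemma coroot_simple i : coroot (simple i) = evec n i.
Proof. by case: hRD => _ [_ [_ [_ [_ [_ [_ [_ [_ h]]]]]]]]; apply: h. Qed.

Lemma l_le_n (i : 'I_l) : (i < n)%N.
Proof.
have := pair_coroot (simple_root i); rewrite coroot_simple /pairZ => h.
rewrite ltnNge; apply/negP => ni; move: h; rewrite big1 // => k _.
by rewrite mxE ltn_eqF ?mulr0 // (leq_trans (ltn_ord k)).
Qed.

Definition wid (i : 'I_l) : 'I_n := Ordinal (l_le_n i).

Lemma pair_simple_coroot lam i : pairZ lam (coroot (simple i)) = lam (wid i) 0.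
Proof. by rewrite coroot_simple pairZC -(pairZ_evec (wid i)). Qed.

Lemma reflK al : al \in roots -> s al *m s al = 1%:M.
Proof. by move=> /pair_coroot; apply: refl_sq. Qed.

Lemma reflKv al lam : al \in roots -> s al *m (s al *m lam) = lam.
Proof. by move=> ha; rewrite mulmxA reflK // mul1mx. Qed.

Lemma creflK al : al \in roots -> cs al *m cs al = 1%:M.
Proof. by move=> ha; rewrite crefl_tr -trmx_mul reflK // trmx1. Qed.

Lemma refl_inj al : al \in roots -> injective (mulmx (s al) : 'cV_n -> 'cV_n).
Proof. by move=> ha x y /(congr1 (mulmx (s al))); rewrite !reflKv. Qed.

Lemma crefl_inj al : al \in roots -> injective (mulmx (cs al) : 'cV_n -> 'cV_n).
Proof.
by move=> ha x y /(congr1 (mulmx (cs al))); rewrite !mulmxA creflK // !mul1mx.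
Qed.

Lemma refl_self al : al \in roots -> s al *m al = - al.
Proof.
by move=> ha; rewrite reflE pair_coroot // scaler_nat mulr2n opprD addNKr.
Qed.

Lemma crefl_self al : al \in roots -> cs al *m coroot al = - coroot al.
Proof.
by move=> ha; rewrite creflE pair_coroot // scaler_nat mulr2n opprD addNKr.
Qed.

Lemma root_opp al : al \in roots -> - al \in roots.
Proof. by move=> ha; rewrite -refl_self //; apply: refl_root. Qed.

Lemma root_neq0 al : al \in roots -> al != 0.
Proof.
move=> ha; apply/eqP => a0; have := pair_coroot ha.
by rewrite a0 pairZ0l.
Qed.

Lemma perm_roots_refl al : al \in roots -> perm_eq (map (mulmx (s al)) roots) roots.
Proof.
by move=> ha; apply: map_perm_self (refl_inj ha) _ => [|be]; [exact: roots_uniq | exact: refl_root].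
Qed.

Lemma perm_coroots_crefl al : al \in roots ->
  perm_eq (map (mulmx (cs al)) (map coroot roots)) (map coroot roots).
Proof.
move=> ha; apply: map_perm_self (crefl_inj ha) _ => [|_ /mapP[be hb ->]].
  exact: coroots_uniq.
exact: crefl_coroot.
Qed.

(** The canonical W-invariant form on X^*(A), integral and semidefinite. It ties the abstract
    function [coroot] to the roots: a coroot is a multiple of the vector [cmapv] that the form
    attaches to its root. *)
Definition cform lam mu : int :=
  \sum_(g <- roots) pairZ lam (coroot g) * pairZ mu (coroot g).
Definition cmapv lam : 'cV[int]_n :=
  \sum_(g <- roots) pairZ lam (coroot g) *: coroot g.

Lemma cformE lam mu : cform lam mu = pairZ lam (cmapv mu).
Proof.
by rewrite pairZ_sumr; apply: eq_bigr => g _; rewrite pairZZr mulrC.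
Qed.

Lemma cformC lam mu : cform lam mu = cform mu lam.
Proof. by apply: eq_bigr => g _; rewrite mulrC. Qed.

Lemma cform_refl al lam mu : al \in roots ->
  cform (s al *m lam) (s al *m mu) = cform lam mu.
Proof.
move=> ha; rewrite /cform -!(big_map coroot xpredT (fun g => pairZ _ g * pairZ _ g)).
rewrite -[RHS](perm_big _ (perm_coroots_crefl ha)) [RHS]big_map; apply: eq_bigr => g _.
by rewrite !pairZ_mull -crefl_tr.
Qed.

(** The reflection in al preserves the form and negates al; expanding the form on the two reflected
    arguments gives the identity. *)
Lemma cform_root lam al : al \in roots ->
  2 * cform lam al = pairZ lam (coroot al) * cform al al.
Proof.
move=> ha; have := cform_refl lam al ha; rewrite refl_self // reflE cformC cformE.
rewrite pairZNl -cformE cformC cformE pairZBl pairZZl -!cformE.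
lia.
Qed.

(* As cmapv is W-equivariant and linear, this makes coroot W-equivariant and
   expands the coroot of al on the simple coroots with the signs of al. *)
Lemma cmapv_root al : al \in roots -> 2 *: cmapv al = cform al al *: coroot al.
Proof.
move=> ha; apply: pairZ_extr => lam; rewrite !pairZZr -cformE cform_root //.
by rewrite mulrC.
Qed.

Lemma cform_gt0 al : al \in roots -> 0 < cform al al.
Proof.
move=> ha; rewrite /cform (big_rem al) //= pair_coroot //.
apply: ltr_pwDl => //; apply: sumr_ge0 => g _.
by rewrite -expr2 sqr_ge0.
Qed.

(** The axioms say that the reflected coroot is some coroot, not which one. Equivariance of [cmapv]
    identifies it, after cancelling the norm of be, which the reflection keeps. *)
Lemma coroot_refl al be : al \in roots -> be \in roots ->
  coroot (s al *m be) = cs al *m coroot be.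
Proof.
move=> ha hb; have hab := refl_root ha hb.
have q0 := lt0r_neq0 (cform_gt0 hb).
have e : cmapv (s al *m be) = cs al *m cmapv be.
  apply: pairZ_extr => lam; rewrite crefl_tr -pairZ_mull -!cformE.
  by rewrite -{1}(reflKv lam ha) cform_refl.
have := cmapv_root hab; rewrite cform_refl // e scalemxAr cmapv_root // -scalemxAr.
move=> h; apply/matrixP => i j; have /matrixP/(_ i j) := h; rewrite !mxE.
by move=> /(mulfI q0) ->.
Qed.

Lemma coroot_opp al : al \in roots -> coroot (- al) = - coroot al.
Proof. by move=> ha; rewrite -refl_self // coroot_refl // crefl_self. Qed.

Lemma refl_opp al : al \in roots -> s (- al) = s al.
Proof.
by move=> ha; rewrite coroot_opp // /refl linearN mulNmx mulmxN opprK.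
Qed.

Lemma refl_conj al be : al \in roots -> be \in roots ->
  s (s al *m be) = s al *m s be *m s al.
Proof.
move=> ha hb; rewrite coroot_refl // [refl (_ *m be) _]/refl trmx_mul crefl_tr trmxK.
rewrite -[X in X - _](reflK ha) -[X in X *m s al - _]mulmx1 !mulmxA.
by rewrite -mulmxBl -(mulmxA _ be) -mulmxBr.
Qed.

(** * Expansions on the simple roots, positivity and the dominance order *)

Lemma simple_combE c lam : pairZ (simple_comb simple c) lam = \sum_i c i * pairZ (simple i) lam.
Proof. by rewrite pairZ_suml; apply: eq_bigr => i _; rewrite pairZZl. Qed.

Lemma simple_combD c c' : simple_comb simple c + simple_comb simple c' =
  simple_comb simple (fun i => c i + c' i).
Proof. by rewrite -big_split; apply: eq_bigr => i _ /=; rewrite scalerDl. Qed.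

Lemma simple_combZ a c : a *: simple_comb simple c = simple_comb simple (fun i => a * c i).
Proof. by rewrite scaler_sumr; apply: eq_bigr => i _; rewrite scalerA. Qed.

Lemma simple_combN c : - simple_comb simple c = simple_comb simple (fun i => - c i).
Proof. by rewrite -sumrN; apply: eq_bigr => i _; rewrite scaleNr. Qed.

Lemma simple_comb1 i : simple i = simple_comb simple (fun j => (j == i)%:R).
Proof.
rewrite /simple_comb (bigD1 i) //= eqxx scale1r big1 ?addr0 // => j /negbTE->.
by rewrite scale0r.
Qed.

Lemma simple_comb_inj c c' : simple_comb simple c = simple_comb simple c' -> c =1 c'.
Proof.
move=> e i; apply/eqP; rewrite -subr_eq0; apply/eqP.
apply: (simple_free (c := fun i => c i - c' i)).
by rewrite -[LHS]simple_combD -simple_combN e subrr.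
Qed.

Lemma coroot_coord al c (k : 'I_n) : al \in roots -> al = simple_comb simple c ->
  cform al al * coroot al k 0 =
  \sum_i c i * (cform (simple i) (simple i) * evec n i k 0).
Proof.
move=> ha e; have /matrixP/(_ k 0) := cmapv_root ha; rewrite !mxE => <-.
have -> : cmapv al = \sum_i c i *: cmapv (simple i).
  apply: pairZ_extr => lam; rewrite -cformE cformC {1}e cformE simple_combE pairZ_sumr.
  by apply: eq_bigr => i _; rewrite pairZZr -!cformE cformC.
rewrite summxE mulr_sumr; apply: eq_bigr => i _.
have /matrixP/(_ k 0) := cmapv_root (simple_root i); rewrite coroot_simple !mxE => <-.
by ring.
Qed.

Lemma coroot_coord_ge al (k : 'I_n) : al \in roots -> (l <= k)%N -> coroot al k 0 = 0.
Proof.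
move=> ha lk; have [c [e _]] := root_comb ha; have := coroot_coord k ha e.
rewrite big1 => [/eqP|i _]; last first.
  by rewrite mxE gtn_eqF ?mulr0 // (leq_trans (ltn_ord i)).
by rewrite mulf_eq0 (negbTE (lt0r_neq0 (cform_gt0 ha))) => /eqP.
Qed.

Local Notation pos := (posroot roots simple).
Local Notation dle := (dom_le simple).

Lemma dle_refl lam : dle lam lam.
Proof.
by exists (fun=> 0); split=> //; rewrite subrr /simple_comb big1 // => i _; rewrite scale0r.
Qed.

Lemma dle_trans lam mu nu : dle lam mu -> dle mu nu -> dle lam nu.
Proof.
move=> [c [ec c0]] [d [ed d0]]; exists (fun i => c i + d i); split.
  by rewrite -simple_combD -ec -ed; apply/matrixP => i j; rewrite !mxE; ring.
by move=> i; apply: addr_ge0.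
Qed.

Lemma dle_subl lam mu : dle lam (lam + mu) <-> dle 0 mu.
Proof. by rewrite /dom_le subr0 addrC addKr. Qed.

Lemma dle0D lam mu : dle 0 lam -> dle 0 mu -> dle 0 (lam + mu).
Proof. by move=> h1 h2; apply: dle_trans h1 _; apply/dle_subl. Qed.

Lemma dle0Z (c : int) lam : 0 <= c -> dle 0 lam -> dle 0 (c *: lam).
Proof.
move=> c0 [d [e d0]]; exists (fun i => c * d i); rewrite subr0 in e.
by split; [rewrite subr0 e simple_combZ | move=> i; apply: mulr_ge0].
Qed.

Lemma dle_sub lam mu : dle lam mu <-> dle 0 (mu - lam).
Proof. by rewrite /dom_le subr0. Qed.

Lemma pos_root al : pos al -> al \in roots. Proof. by case. Qed.

Lemma posP al : pos al -> exists c, al = simple_comb simple c /\ forall i, 0 <= c i.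
Proof. by case=> _ [c []]; rewrite subr0; exists c. Qed.

Lemma pos_or_neg al : al \in roots -> pos al \/ pos (- al).
Proof.
move=> ha; have [c [e [c0|c0]]] := root_comb ha; [left|right].
  by split=> //; exists c; rewrite subr0.
split; first exact: root_opp.
exists (fun i => - c i); rewrite subr0 e simple_combN; split=> // i.
by rewrite oppr_ge0.
Qed.

Lemma pos_not_neg al : pos al -> ~ pos (- al).
Proof.
move=> pa /posP[d [ed d0]]; have [c [ec c0]] := posP pa.
have e : simple_comb simple (fun i => c i + d i) = 0.
  by rewrite -simple_combD -ec -ed subrr.
have := root_neq0 (pos_root pa); rewrite ec /simple_comb big1 ?eqxx // => i _.
have := simple_free e i; have := c0 i; have := d0 i => h1 h2 h3.
by have -> : c i = 0; [lia | rewrite scale0r].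
Qed.

Lemma pos_simple i : pos (simple i).
Proof.
split; first exact: simple_root.
by exists (fun j => (j == i)%:R); rewrite subr0 -simple_comb1; split=> // j; case: eqP.
Qed.

Lemma pos_coroot al (k : 'I_n) : pos al -> 0 <= coroot al k 0.
Proof.
move=> pa; have [c [ec c0]] := posP pa; have ha := pos_root pa.
have := coroot_coord k ha ec.
have h : 0 <= \sum_i c i * (cform (simple i) (simple i) * evec n i k 0).
  apply: sumr_ge0 => i _; apply: mulr_ge0 => //; apply: mulr_ge0; last by rewrite mxE; case: eqP.
  exact/ltW/cform_gt0/simple_root.
by move=> e; rewrite -e pmulr_rge0 ?cform_gt0 // in h.
Qed.

(** The reflection changes only the i-th coefficient. If the image were negative, all other
    coefficients of be would vanish, and a root proportional to [simple i] is plus or minus it by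
    reducedness. *)
Lemma pos_refl_simple i be : pos be -> be != simple i -> pos (s (simple i) *m be).
Proof.
move=> pb bi; have hb := pos_root pb; have hi := simple_root i.
have [//|pN] := pos_or_neg (refl_root hi hb).
have [c [ec c0]] := posP pb; have [d [ed d0]] := posP pN.
set k := pairZ be (coroot (simple i)).
have e : d =1 (fun j => - c j + k * (j == i)%:R).
  apply: simple_comb_inj; rewrite -simple_combD -simple_combN -simple_combZ -simple_comb1.
  by rewrite -ed -ec reflE opprB addrC.
have cj j : j != i -> c j = 0.
  by move=> ji; have := e j; have := c0 j; have := d0 j; rewrite (negbTE ji); lia.
have eb : be = c i *: simple i.
  rewrite {1}ec /simple_comb (bigD1 i) //= big1 ?addr0 // => j /cj ->.
  by rewrite scale0r.
have [] := @roots_reduced (simple i) be 1 (c i) hi hb isT; first by rewrite scale1r.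
  by move=> eqb; rewrite eqb eqxx in bi.
by move=> eqb; case: (pos_not_neg (pos_simple i)); rewrite -eqb.
Qed.

(** Twice the usual half-sum of the positive coroots, hence integral. Pairing with it is twice the
    height on the root lattice, and serves as the measure of the inductions on roots and
    characters. *)
Definition rhov : 'cV[int]_n := \sum_(al <- [seq al <- roots | `[< pos al >]]) coroot al.

(** The i-th simple reflection permutes the positive roots other than [simple i], so the sum of
    their coroots is fixed by it and orthogonal to [simple i]; only the coroot of [simple i]
    contributes. *)
Lemma pair_simple_rhov i : pairZ (simple i) rhov = 2.
Proof.
set P := [seq al <- roots | `[< pos al >]].
have uP : uniq P by rewrite filter_uniq // roots_uniq.
have memP al : (al \in P) = `[< pos al >].
  rewrite mem_filter; case: asboolP => //= pa; exact: pos_root pa.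
have iP : simple i \in P by rewrite memP; apply/asboolP/pos_simple.
rewrite /rhov -/P (big_rem (simple i)) //= pairZDr pair_coroot ?simple_root //.
set P' := rem _ _; set v := \sum_(y <- P') _.
suff e : cs (simple i) *m v = v.
  have := pairZ_mull (s (simple i)) (simple i) v; rewrite -crefl_tr e.
  by rewrite refl_self ?simple_root // pairZNl; lia.
have hP' al : (al \in P') = (al != simple i) && `[< pos al >].
  by rewrite mem_rem_uniq // inE memP.
have per : perm_eq (map (mulmx (s (simple i))) P') P'.
  apply: map_perm_self; [exact: rem_uniq | exact: refl_inj (simple_root i) |].
  move=> al; rewrite !hP' => /andP[ai /asboolP pa]; apply/andP; split.
    apply/eqP => e; have := congr1 (mulmx (s (simple i))) e.
    rewrite reflKv ?refl_self ?simple_root // => ea.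
    by apply: (pos_not_neg (pos_simple i)); rewrite -ea.
  by apply/asboolP/pos_refl_simple.
rewrite mulmx_sumr -[RHS](perm_big _ per) /= big_map; apply: eq_big_seq => al.
rewrite hP' => /andP[_ /asboolP/pos_root ha].
by rewrite coroot_refl ?simple_root.
Qed.

Lemma pair_comb_rhov c : pairZ (simple_comb simple c) rhov = 2 * \sum_i c i.
Proof.
by rewrite simple_combE mulr_sumr; apply: eq_bigr => i _; rewrite pair_simple_rhov mulrC.
Qed.

Lemma dle_rhov lam mu : dle lam mu ->
  pairZ lam rhov <= pairZ mu rhov /\ (pairZ lam rhov = pairZ mu rhov -> lam = mu).
Proof.
move=> [c [e c0]]; have := pair_comb_rhov c; rewrite -e pairZBl => h.
have s0 : 0 <= \sum_i c i by apply: sumr_ge0.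
split=> [|eq]; first lia.
have /eqP : \sum_i c i = 0 by lia.
rewrite psumr_eq0 // => /allP h0.
apply/esym/eqP; rewrite -subr_eq0 e /simple_comb big1 // => i _.
by have /= /eqP -> := h0 i (mem_index_enum _); rewrite scale0r.
Qed.

Lemma pos_rhov al : pos al -> 0 < pairZ al rhov.
Proof.
move=> pa; have [h1 h2] := dle_rhov pa.2; rewrite pairZ0l in h1 h2.
rewrite lt_neqAle h1 andbT; apply/eqP => /h2 e.
by have := root_neq0 (pos_root pa); rewrite -e eqxx.
Qed.

Lemma rhov_coord (i : 'I_l) : 0 < rhov (wid i) 0.
Proof.
rewrite /rhov summxE; set P := [seq al <- roots | `[< pos al >]].
have memP al : (al \in P) = `[< pos al >].
  rewrite mem_filter; case: asboolP => //= pa; exact: pos_root pa.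
have iP : simple i \in P by rewrite memP; apply/asboolP/pos_simple.
rewrite (big_rem (simple i)) //= coroot_simple mxE eqxx ltr_pwDl //.
rewrite big_seq; apply: sumr_ge0 => al /mem_rem; rewrite memP => /asboolP.
exact: pos_coroot.
Qed.

Lemma rhov_coord_ge0 k : 0 <= rhov k 0.
Proof.
rewrite summxE big_seq; apply: sumr_ge0 => al; rewrite mem_filter => /andP[/asboolP pa _].
exact: pos_coroot.
Qed.

Lemma rhov_coord_ge (k : 'I_n) : (l <= k)%N -> rhov k 0 = 0.
Proof.
move=> lk; rewrite summxE big_seq big1 // => al; rewrite mem_filter => /andP[_ ha].
exact: coroot_coord_ge.
Qed.

(** * Words in the simple reflections, exchange, and finiteness of W *)

Definition wordmx (w : seq 'I_l) : 'M[int]_n :=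
  foldr (fun i N => s (simple i) *m N) 1%:M w.

Lemma wordmx_cat w w' : wordmx (w ++ w') = wordmx w *m wordmx w'.
Proof. by elim: w => [|i w IH] /=; rewrite ?mul1mx // IH mulmxA. Qed.

Lemma wordmx1 i : wordmx [:: i] = s (simple i).
Proof. by rewrite /= mulmx1. Qed.

Lemma weyl1 : W 1%:M. Proof. by exists [::]. Qed.

Lemma weyl_refl al : al \in roots -> W (s al).
Proof. by move=> ha; exists [:: al]; rewrite /= ha mulmx1. Qed.

Lemma weyl_mul M N : W M -> W N -> W (M *m N).
Proof.
move=> [r [hr ->]] [t [ht ->]]; exists (r ++ t); rewrite all_cat hr ht; split=> //.
by elim: r {hr} => [|al r IH] /=; rewrite ?mul1mx // -mulmxA IH.
Qed.

Lemma weyl_ind (P : 'M[int]_n -> Prop) :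
  P 1%:M -> (forall al M, al \in roots -> W M -> P M -> P (s al *m M)) ->
  forall M, W M -> P M.
Proof.
move=> P1 PM _ [r [hr ->]]; elim: r hr => [//|al r IH] /= /andP[ha hr].
by apply: PM => //; [exists r | apply: IH].
Qed.

Lemma weyl_invP M : W M -> exists N, [/\ W N, M *m N = 1%:M & N *m M = 1%:M].
Proof.
elim/weyl_ind: M / => [|al M ha _ [N [WN e1 e2]]].
  by exists 1%:M; rewrite mulmx1; split=> //; apply: weyl1.
exists (N *m s al); split; first exact: weyl_mul WN (weyl_refl ha).
  by rewrite -!mulmxA (mulmxA M) e1 mul1mx reflK.
by rewrite -!mulmxA (mulmxA (s al)) reflK // mul1mx.
Qed.

Lemma weyl_unit M : W M -> M \in unitmx.
Proof. by move=> /weyl_invP[N [_ /mulmx1_unit[]]]. Qed.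

Lemma weyl_inv M : W M -> W (invmx M).
Proof.
move=> WM; have uM := weyl_unit WM; have [N [WN _ e]] := weyl_invP WM.
by rewrite -[invmx M]mul1mx -e mulmxK.
Qed.

Lemma weyl_root M al : W M -> al \in roots -> M *m al \in roots.
Proof.
move=> WM ha; elim/weyl_ind: M / WM => [|be M hb _ IH]; first by rewrite mul1mx.
by rewrite -mulmxA refl_root.
Qed.

Lemma weyl_refl_conj M al : W M -> al \in roots -> s (M *m al) *m M = M *m s al.
Proof.
move=> WM ha; elim/weyl_ind: M / WM => [|be M hb WM IH].
  by rewrite !mul1mx mulmx1.
rewrite -mulmxA refl_conj ?weyl_root // -!mulmxA (mulmxA (s be) (s be)) reflK //.
by rewrite mul1mx IH.
Qed.

Lemma weyl_wordmx w : W (wordmx w).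
Proof.
elim: w => [|i w IH]; first exact: weyl1.
by apply: weyl_mul IH; apply/weyl_refl/simple_root.
Qed.

(** Otherwise the norm of al, expanded on the simple roots with nonnegative coefficients, would be a
    sum of nonpositive terms. *)
Lemma pos_pair_simple al : pos al -> exists i, 0 < pairZ al (coroot (simple i)).
Proof.
move=> pa; apply: contrapT => /forallNP h; have ha := pos_root pa.
have [c [ec c0]] := posP pa; have := cform_gt0 ha.
rewrite cformE {1}ec simple_combE real_ltNge ?num_real // => /negP; apply.
apply: sumr_le0 => i _; rewrite -cformE mulr_ge0_le0 //.
have := cform_root al (simple_root i); rewrite cformC.
have : pairZ al (coroot (simple i)) <= 0 by rewrite leNgt; apply/negP/h.
have := cform_gt0 (simple_root i) => h1 h2.
have : pairZ al (coroot (simple i)) * cform (simple i) (simple i) <= 0.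
  by rewrite mulr_le0_ge0 // ltW.
lia.
Qed.

(** Induction on the height: a simple reflection with positive pairing lowers al, and conjugating by
    it relates the two reflections. *)
Lemma pos_refl_word al : pos al -> exists w, s al = wordmx w.
Proof.
move: {2}`|pairZ al rhov|%N (leqnn `|pairZ al rhov|%N) => N.
elim: N al => [|N IH] al hN pa; first by have := pos_rhov pa; lia.
have [/eqP|/negP] := boolP [exists i, al == simple i]; last first.
  move=> ns; have [i hi] := pos_pair_simple pa.
  have ai : al != simple i by apply/eqP => e; apply: ns; apply/existsP; exists i; rewrite e.
  have pb := pos_refl_simple pa ai.
  have [|w ew] := IH _ _ pb.
    have := pos_rhov pb; rewrite reflE pairZBl pairZZl pair_simple_rhov; lia.
  exists (i :: w ++ [:: i]); rewrite /= wordmx_cat wordmx1 mulmxA -ew.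
  rewrite -refl_conj ?simple_root ?(pos_root pb) //.
  by rewrite reflKv // simple_root.
by move=> /eqP/existsP[i /eqP->]; exists [:: i]; rewrite wordmx1.
Qed.

Lemma weyl_word M : W M -> exists w, M = wordmx w.
Proof.
elim/weyl_ind: M / => [|al M ha _ [w ->]]; first by exists [::].
have [w' ->] : exists w', s al = wordmx w'.
  have [/pos_refl_word //|/pos_refl_word] := pos_or_neg ha.
  by rewrite refl_opp.
by exists (w' ++ w); rewrite wordmx_cat.
Qed.

(** Reading the word from the right, consider the letter j at which the image of [simple i] turns
    negative. Just before, the image is positive and so equals [simple j]; the reflection in j is
    then a conjugate of the reflection in i, and the letter cancels. *)
Lemma wordmx_exchange w i : ~ pos (wordmx w *m simple i) ->
  exists2 w', (size w' < size w)%N & wordmx w *m s (simple i) = wordmx w'.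
Proof.
elim: w => [|j w IH] /=; first by rewrite mul1mx => /(_ (pos_simple i)).
have hi := simple_root i; have hj := simple_root j.
have [pb|nb _] := pselect (pos (wordmx w *m simple i)); last first.
  by have [w' sw ew] := IH nb; exists (j :: w') => //=; rewrite -mulmxA ew.
rewrite -mulmxA => h; exists w => //.
have -> : simple j = wordmx w *m simple i.
  by apply/eqP; rewrite eq_sym; apply: contra_notT h; apply: pos_refl_simple.
rewrite weyl_refl_conj //; last exact: weyl_wordmx.
by rewrite -mulmxA reflK // mulmx1.
Qed.

(** If the last letter is i, the rest of the word sends [simple i] to a negative root, so exchange
    shortens the word without changing its matrix. *)
Lemma wordmx_pos w : (forall i, pos (wordmx w *m simple i)) -> wordmx w = 1%:M.
Proof.
move: {2}(size w) (leqnn (size w)) => N; elim: N w => [[]//|N IH] w.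
case/lastP: w => [//|w i]; rewrite size_rcons ltnS => sw.
rewrite -cats1 wordmx_cat wordmx1 => h.
have nb : ~ pos (wordmx w *m simple i).
  have := h i; rewrite -mulmxA refl_self ?simple_root // mulmxN => pN pP.
  exact: pos_not_neg pP pN.
have [w' sw' e] := wordmx_exchange nb; rewrite e in h *.
by apply: IH h; rewrite (leq_trans _ sw) // ltnW.
Qed.

Definition dominant lam := forall i, 0 <= pairZ lam (coroot (simple i)).

(** The last letter i lowers lam by a nonnegative multiple of [simple i], and the rest of the word
    sends that simple root to a positive root, unless exchange shortens the word. *)
Lemma dominant_dle lam M : dominant lam -> W M -> dle (M *m lam) lam.
Proof.
move=> dl /weyl_word[w ->].
move: {2}(size w) (leqnn (size w)) => N; elim: N w => [[_|//]|N IH w].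
  by rewrite mul1mx; apply: dle_refl.
case/lastP: w => [_|w i]; first by rewrite mul1mx; apply: dle_refl.
rewrite size_rcons ltnS -cats1 wordmx_cat wordmx1 => sw.
have [pb|nb] := pselect (pos (wordmx w *m simple i)); last first.
  have [w' sw' e] := wordmx_exchange nb; rewrite e; apply: IH.
  by rewrite (leq_trans _ sw) // ltnW.
apply: dle_trans (IH _ sw); rewrite -mulmxA reflE mulmxBr -scalemxAr.
by apply/dle_sub; rewrite opprB addrC subrK; apply: dle0Z => //; case: pb.
Qed.

Lemma weyl_faithful M N : W M -> W N -> (forall al, al \in roots -> M *m al = N *m al) -> M = N.
Proof.
move=> WM WN h; have [w e] := weyl_word (weyl_mul (weyl_inv WN) WM).
have : wordmx w = 1%:M.
  apply: wordmx_pos => i; rewrite -e -mulmxA h ?simple_root // mulKmx ?weyl_unit //.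
  exact: pos_simple.
by rewrite -e => /(congr1 (mulmx N)); rewrite mulKVmx ?weyl_unit // mulmx1.
Qed.

(** W is given by words of arbitrary length, but it acts faithfully on the roots; recording the
    index of the image of each root embeds it in a finite type. The sums over W and over its orbits
    in the definitions get their meaning from this. *)
Lemma finite_weyl : finite_set W.
Proof.
pose k := size roots.
pose f M : {ffun 'I_k -> 'I_k.+1} :=
  [ffun i : 'I_k => inord (index (M *m nth 0 roots i) roots)].
suff fW : {in W &, injective f} by rewrite -(eq_finite_set (inj_card_eq fW)).
move=> M N /set_mem WM /set_mem WN /ffunP e; apply: weyl_faithful => // al ha.
have hi : (index al roots < k)%N by rewrite index_mem.
have := e (Ordinal hi); rewrite !ffunE /= nth_index // => /(congr1 val) /=.
rewrite !inordK ?ltnS ?index_size // => /(congr1 (nth 0 roots)).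
by rewrite !nth_index // weyl_root.
Qed.

(* The contragredient action on cocharacters. *)
Definition cow M : 'M[int]_n := (invmx M)^T.

Lemma cow1 : cow 1%:M = 1%:M. Proof. by rewrite /cow invmx1 trmx1. Qed.

Lemma cowM M N : W M -> W N -> cow (M *m N) = cow M *m cow N.
Proof.
move=> /weyl_unit uM /weyl_unit uN; rewrite /cow -trmx_mul; congr (_^T).
have uMN : M *m N \in unitmx by rewrite unitmx_mul uM.
rewrite -[RHS](mulmxK uMN).
by rewrite -!mulmxA (mulmxA (invmx M)) mulVmx // mul1mx mulmxA mulVmx // mul1mx.
Qed.

Lemma cow_refl al : al \in roots -> cow (s al) = cs al.
Proof.
move=> ha; rewrite /cow crefl_tr; congr (_^T).
by rewrite -[RHS]mulmx1 -(mulmxV (weyl_unit (weyl_refl ha))) mulmxA reflK // mul1mx.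
Qed.

Lemma cow_coord M x (k : 'I_n) : W M -> (l <= k)%N -> (cow M *m x) k 0 = x k 0.
Proof.
move=> WM lk; elim/weyl_ind: M / WM => [|al M ha WM IH]; first by rewrite cow1 mul1mx.
rewrite cowM //; last exact: weyl_refl.
rewrite cow_refl // -mulmxA creflE !mxE (coroot_coord_ge ha lk) mulr0 subr0.
by rewrite -IH mxE.
Qed.

Lemma weyl_fix M lam : W M -> (forall i, lam (wid i) 0 = 0) -> M *m lam = lam.
Proof.
move=> WM h; elim/weyl_ind: M / WM => [|al M ha _ IH]; first by rewrite mul1mx.
rewrite -mulmxA IH reflE /pairZ big1 ?scale0r ?subr0 // => k _.
have [kl|lk] := ltnP k l; last by rewrite coroot_coord_ge // mulr0.
by have := h (Ordinal kl); rewrite (_ : wid _ = k) => [->|]; [rewrite mul0r | apply: val_inj].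
Qed.

Lemma weyl_enum : exists Ws : seq 'M[int]_n, uniq Ws /\ forall M, M \in Ws <-> W M.
Proof.
have /finite_seqP[Ws e] := finite_weyl; exists (undup Ws); split; first exact: undup_uniq.
by move=> M; rewrite mem_undup e.
Qed.

Lemma perm_weyl_l Ws M : uniq Ws -> (forall N, N \in Ws <-> W N) -> W M ->
  perm_eq (map (mulmx M) Ws) Ws.
Proof.
move=> uW mW WM; apply: map_perm_self => // [A B e|N /mW WN].
  by rewrite -[A](mulKmx (weyl_unit WM)) e mulKmx // weyl_unit.
by apply/mW/weyl_mul.
Qed.

Lemma perm_weyl_r Ws M : uniq Ws -> (forall N, N \in Ws <-> W N) -> W M ->
  perm_eq (map (mulmx^~ M) Ws) Ws.
Proof.
move=> uW mW WM; apply: map_perm_self => // [A B /= e|N /mW WN].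
  by rewrite -[A](mulmxK (weyl_unit WM)) e mulmxK // weyl_unit.
by apply/mW/weyl_mul.
Qed.

(** A simple reflection at a negative pairing raises the pairing with [rhov], which is bounded on
    the finite orbit. *)
Lemma dominant_rep lam : exists2 M, W M & dominant (M *m lam).
Proof.
have [Ws [uW mW]] := weyl_enum.
pose B : int := \sum_(M <- Ws) `|pairZ (M *m lam) rhov|.
have hB M : W M -> pairZ (M *m lam) rhov <= B.
  move=> /mW hM; apply: (le_trans (ler_norm _)); rewrite /B (big_rem M) //=.
  by rewrite lerDl; apply: sumr_ge0.
have [k hk] : exists k : nat, B - pairZ (1%:M *m lam) rhov <= k%:Z.
  by exists `|B - pairZ (1%:M *m lam) rhov|%N; lia.
elim: k 1%:M weyl1 hk => [|k IH] M WM hk.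
  exists M => // i; rewrite leNgt; apply/negP => hi.
  have Wi := weyl_mul (weyl_refl (simple_root i)) WM.
  have := hB _ Wi; rewrite -mulmxA reflE pairZBl pairZZl pair_simple_rhov; lia.
have [d|] := pselect (dominant (M *m lam)); first by exists M.
move=> /existsNP[i hi]; have Wi := weyl_mul (weyl_refl (simple_root i)) WM.
apply: (IH _ Wi); rewrite -mulmxA reflE pairZBl pairZZl pair_simple_rhov; lia.
Qed.

Lemma dominant_rhov lam : dominant lam -> 0 <= pairZ lam rhov.
Proof.
move=> d; apply: sumr_ge0 => k _.
have [kl|lk] := ltnP k l; last by rewrite rhov_coord_ge // mulr0.
apply: mulr_ge0; last exact: rhov_coord_ge0.
by have := d (Ordinal kl); rewrite pair_simple_coroot (_ : wid _ = k) //; apply: val_inj.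
Qed.

End RootDatum.

(** Only the basis vectors in the support of lam are tested, so the principle also serves for the
    sublattice where some coordinates vanish. *)
Lemma int_span n (P : 'cV[int]_n -> Prop) (lam : 'cV[int]_n) :
  P 0 -> (forall x y, P x -> P y -> P (x - y)) ->
  (forall k : 'I_n, lam k 0 != 0 -> P (evec n k)) -> P lam.
Proof.
move=> P0 PB Pe.
have PN x : P x -> P (- x) by move=> h; rewrite -sub0r; apply: PB.
have PD x y : P x -> P y -> P (x + y) by move=> h1 h2; rewrite -(opprK y); apply/PB/PN.
have -> : lam = \sum_k lam k 0 *: evec n k.
  apply/matrixP => i j; rewrite ord1 summxE (bigD1 i) //= !mxE eqxx mulr1.
  rewrite big1 ?addr0 // => k ki; rewrite !mxE (inj_eq val_inj) eq_sym (negbTE ki).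
  by rewrite mulr0.
apply: big_rec => // k x _ Px; apply/(PD _ _ _ Px).
have [->|/Pe Pk] := eqVneq (lam k 0) 0; first by rewrite scale0r.
have PM m : P (m%:Z *: evec n k).
  by rewrite -natz scaler_nat; elim: m => [//|m IH]; rewrite mulrS; apply/PD.
by case: (lam k 0) => m; rewrite ?NegzE ?scaleNr; [|apply/PN].
Qed.

(** * Separation of Weyl orbits by orbit sums *)

(** Dedekind's argument: subtracting chi(x0) times the relation from its translate by x0 eliminates
    chi and multiplies c by f(x0) - chi(x0), which is nonzero. The other characters may repeat, as
    the conjugates of a point may coincide. *)
Lemma characters_independent (V : zmodType) (K : comNzRingType) (f : V -> K) (c : K)
    (r : seq (K * (V -> K))) :
  (forall x y : K, x * y = 0 -> x = 0 \/ y = 0) ->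
  (f 0 = 1) -> (forall x y, f (x + y) = f x * f y) ->
  (forall d, d \in r -> d.2 <> f /\ forall x y, d.2 (x + y) = d.2 x * d.2 y) ->
  (forall x, c * f x + \sum_(d <- r) d.1 * d.2 x = 0) -> c = 0.
Proof.
move=> dom f0 fM; move: {2}(size r) (erefl (size r)) => N.
elim: N r c => [|N IH] [|[d chi] r] //= c => [_|[sr]] hr h.
  by have := h 0; rewrite big_nil addr0 f0 mulr1.
have [nf chiM] := hr _ (mem_head _ _); rewrite /= in nf chiM.
have /existsNP[x0 hx0] : ~ forall x, chi x = f x by move=> e; apply/nf/funext.
set r' := [seq (e.1 * (e.2 x0 - chi x0), e.2) | e <- r].
have hr' e : e \in r' -> e.2 <> f /\ forall x y, e.2 (x + y) = e.2 x * e.2 y.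
  by move=> /mapP[e' er ->]; apply: (hr e'); rewrite inE er orbT.
have [] := dom c (f x0 - chi x0); last first.
- by move=> /eqP; rewrite subr_eq0 eq_sym => /eqP.
- by [].
apply: (IH r') => // [|x]; first by rewrite size_map.
have h1 := h x; have := h (x0 + x); rewrite !big_cons /= fM chiM in h1 * => h2.
have e : \sum_(j <- r) j.1 * j.2 (x0 + x) = \sum_(j <- r) j.1 * (j.2 x0 * j.2 x).
  by apply: eq_big_seq => j jr; have [_ ->] := hr j (mem_behead (s := _ :: _) jr).
rewrite e in h2; rewrite big_map /=.
transitivity ((c * (f x0 * f x) + (d * (chi x0 * chi x) + \sum_(j <- r) j.1 * (j.2 x0 * j.2 x)))
  - chi x0 * (c * f x + (d * chi x + \sum_(j <- r) j.1 * j.2 x))); last first.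
  by rewrite h1 h2 mulr0 subr0.
have -> : \sum_(j <- r) j.1 * (j.2 x0 - chi x0) * j.2 x =
  \sum_(j <- r) j.1 * (j.2 x0 * j.2 x) - chi x0 * \sum_(j <- r) j.1 * j.2 x.
  by rewrite mulr_sumr -sumrB; apply: eq_bigr => j _; ring.
by ring.
Qed.

Section Separation.
Variables (n l : nat) (roots : seq 'cV[int]_n) (coroot : 'cV[int]_n -> 'cV[int]_n).
Variable simple : 'I_l -> 'cV[int]_n.
Hypothesis hRD : root_datum_hyp roots coroot simple.
Variable K : comNzRingType.
Hypothesis dom : forall x y : K, x * y = 0 -> x = 0 \/ y = 0.
Hypothesis char0 : forall k : nat, k.+1%:R <> 0 :> K.
Variable Ws : seq 'M[int]_n.
Hypothesis uW : uniq Ws.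
Local Notation W := (weyl roots coroot).
Hypothesis mW : forall M, M \in Ws <-> W M.
Implicit Types (a b : 'cV[int]_n -> K) (lam mu : 'cV[int]_n).

Definition character a := a 0 = 1 /\ forall lam mu, a (lam + mu) = a lam * a mu.
(** The sum runs over W and not over the orbit, so that the product formula needs no stabilizers;
    the resulting integer factors are cancelled in characteristic zero. *)
Definition orbsum a lam := \sum_(M <- Ws) a (M *m lam).

Lemma mulrn_inj (x y : K) k : (0 < k)%N -> x *+ k = y *+ k -> x = y.
Proof.
case: k => // k _ /eqP; rewrite -subr_eq0 -mulrnBl -mulr_natr => /eqP/dom[/eqP|/char0//].
by rewrite subr_eq0 => /eqP.
Qed.

Lemma Ws_gt0 : (0 < size Ws)%N.
Proof.
have /mW : W 1%:M by apply: weyl1.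
by case: Ws.
Qed.

Lemma orbsum_weyl a lam M : W M -> orbsum a (M *m lam) = orbsum a lam.
Proof.
move=> WM; rewrite /orbsum -[RHS](perm_big _ (perm_weyl_r hRD uW mW WM)) big_map.
by apply: eq_bigr => N _; rewrite mulmxA.
Qed.

Lemma orbsum_mul a lam mu : character a ->
  orbsum a lam * orbsum a mu = \sum_(M <- Ws) orbsum a (lam + M *m mu).
Proof.
move=> [_ aM]; rewrite [RHS]exchange_big /= mulr_suml; apply: eq_big_seq => N /mW WN.
rewrite /orbsum -(perm_big _ (perm_weyl_l hRD uW mW WN)) big_map mulr_sumr.
by apply: eq_bigr => M _; rewrite -aM mulmxDr mulmxA.
Qed.

Lemma orbsum_fixed a lam : (forall i, lam (wid hRD i) 0 = 0) ->
  orbsum a lam = a lam *+ size Ws.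
Proof.
move=> h; rewrite /orbsum (eq_big_seq (fun=> a lam)) ?big_const_seq ?count_predT.
  by rewrite iter_addr_0.
by move=> M /mW WM; rewrite (weyl_fix (hRD := hRD)).
Qed.

Lemma orbsum_eq_dominant a b :
  character a -> character b ->
  (forall k : 'I_n, orbsum a (evec n k) = orbsum b (evec n k)) ->
  forall lam, dominant coroot simple lam -> orbsum a lam = orbsum b lam.
Proof.
move=> ca cb hab lam.
move: {2}`|pairZ lam (rhov roots coroot simple)|%N
  (leqnn `|pairZ lam (rhov roots coroot simple)|%N) => N.
set rho := rhov roots coroot simple.
elim/ltn_ind: N lam => N IH lam hN dlam.
(* Here lam is in the span of the W-fixed omega_k with k >= l, on which the sum is the order of W
   times the character. Cancelling this order gives agreement on each omega_k, hence on the span. *)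
have [h0|] := pselect (forall i, lam (wid hRD i) 0 = 0).
  rewrite !orbsum_fixed //; congr (_ *+ _).
  have wfix (k : 'I_n) i : lam k 0 != 0 -> evec n k (wid hRD i) 0 = 0.
    move=> hk; rewrite mxE; case: eqP => // e; case/eqP: hk; rewrite -(h0 i).
    by congr (lam _ _); apply: val_inj.
  apply: (int_span (P := fun mu => a mu = b mu)) => [|x y ex ey|k /wfix hk].
  - by rewrite ca.1 cb.1.
  - have inv f : character f -> f y * f (- y) = 1 by move=> [f0 fM]; rewrite -fM subrr.
    rewrite ca.2 cb.2 ex; congr (_ * _).
    by rewrite -[LHS]mul1r -(inv _ cb) -ey mulrAC (inv _ ca) mul1r.
  - by have := hab k; rewrite !orbsum_fixed //; apply/mulrn_inj/Ws_gt0.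
move=> /existsNP[i hi].
have lami : 0 < lam (wid hRD i) 0.
  have di : 0 <= lam (wid hRD i) 0 by rewrite -pair_simple_coroot; apply: dlam.
  by rewrite lt0r di andbT; apply/eqP.
(* Removing omega_i keeps lam dominant, since the i-th pairing is at least 1, and lowers the pairing
   with [rho]. *)
pose e := evec n (wid hRD i); pose lam' := lam - e.
have ecoord j : e (wid hRD j) 0 = (j == i)%:R by rewrite mxE.
have dlam' : dominant coroot simple lam'.
  move=> j; have := dlam j; rewrite !(pair_simple_coroot hRD) mxE [X in _ + X]mxE ecoord.
  by case: eqP => [->|_]; [rewrite subr_ge0 // => _; lia | rewrite subr0].
have de : dominant coroot simple e.
  by move=> j; rewrite (pair_simple_coroot hRD) ecoord.
have hte : pairZ lam' rho < pairZ lam rho.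
  by rewrite pairZBl ltrBlDr ltrDl pairZ_evec (rhov_coord hRD).
have p0 : 0 <= pairZ lam' rho by exact: (dominant_rhov hRD).
have e1 : orbsum a lam' = orbsum b lam' by apply: (IH `|pairZ lam' rho|%N) => //; lia.
(* [P] marks the terms of the product that are conjugate to lam. The term M = 1 is one of them, so
   their number is positive and can be cancelled. Every other term has a dominant conjugate strictly
   below lam, to which the induction applies. *)
pose P M := `[< exists2 N, W N & N *m (lam' + M *m e) = lam >].
have split f : character f -> orbsum f lam' * orbsum f e =
    orbsum f lam *+ count P Ws + \sum_(M <- Ws | ~~ P M) orbsum f (lam' + M *m e).
  move=> cf; rewrite orbsum_mul // (bigID P) /=; congr (_ + _).
  rewrite (eq_bigr (fun=> orbsum f lam)) => [|M /asboolP[N' WN' <-]].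
    by rewrite big_const_seq iter_addr_0.
  by rewrite orbsum_weyl.
have := split b cb; rewrite -e1 -(hab _) split // => /eqP.
rewrite [X in _ == _ + X](_ : _ = \sum_(M <- Ws | ~~ P M) orbsum a (lam' + M *m e)); last first.
  apply/esym; rewrite big_seq_cond [RHS]big_seq_cond.
  apply: eq_bigr => M /andP[/mW WM /asboolPn nP].
  have [N' WN' dN] := dominant_rep hRD (lam' + M *m e).
  rewrite -(orbsum_weyl a _ WN') -(orbsum_weyl b _ WN').
  set nu := N' *m _ in dN *.
  have le_nu : dom_le simple nu lam.
    have -> : lam = lam' + e by rewrite subrK.
    rewrite /nu mulmxDr mulmxA; apply/dle_sub.
    rewrite (_ : _ - _ = (lam' - N' *m lam') + (e - N' *m M *m e)); last first.
      by apply/matrixP => ? ?; rewrite !mxE; ring.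
    have /dle_sub d1 := dominant_dle hRD dlam' WN'.
    have /dle_sub d2 := dominant_dle hRD de (weyl_mul WN' WM).
    exact: dle0D d1 d2.
  have [l1 l2] := dle_rhov hRD le_nu.
  have ne : pairZ nu rho <> pairZ lam rho.
    by move=> /l2 enu; apply: nP; exists N'.
  have := dominant_rhov hRD dN; rewrite -/rho => p1.
  apply: (IH `|pairZ nu rho|%N) => //.
  by move: l1 ne; rewrite -/rho => l1 ne; lia.
rewrite (inj_eq (addIr _)) => /eqP/mulrn_inj -> //.
rewrite -has_count; apply/hasP; exists 1%:M; first by apply/mW; apply: weyl1.
by apply/asboolP; exists 1%:M; rewrite ?mul1mx ?subrK //; apply: weyl1.
Qed.

Lemma weyl_separation a b : character a -> character b ->
  (forall k : 'I_n, orbsum a (evec n k) = orbsum b (evec n k)) ->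
  exists2 M, W M & forall lam, b lam = a (M *m lam).
Proof.
move=> ca cb hab.
have hS lam : orbsum a lam = orbsum b lam.
  have [M WM d] := dominant_rep hRD lam.
  by rewrite -(orbsum_weyl a _ WM) -(orbsum_weyl b _ WM) (orbsum_eq_dominant ca cb).
apply: contrapT => nex.
pose tw f (M : 'M[int]_n) lam : K := f (M *m lam).
pose P M := `[< tw b M = b >].
have twM f M x y : character f -> tw f M (x + y) = tw f M x * tw f M y.
  by move=> [_ fM]; rewrite /tw mulmxDr fM.
(* If b is no conjugate of a, it differs from every character in [r]. But [hS] is a relation between
   b and [r] in which b has the coefficient [count P Ws], a positive integer. *)
pose r : seq (K * ('cV[int]_n -> K)) :=
  [seq (-1, tw a M) | M <- Ws] ++ [seq (1, tw b M) | M <- Ws & ~~ P M].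
have : (count P Ws)%:R = 0 :> K.
  apply: (@characters_independent _ K b _ r dom cb.1 cb.2) => [d|lam].
    rewrite mem_cat => /orP[] /mapP[M]; last rewrite mem_filter => /andP[/asboolPn nP _].
      move=> /mW WM -> /=; split; last by move=> *; apply: twM.
      by move=> e; apply: nex; exists M => // mu; rewrite -e.
    by move=> -> /=; split=> // *; apply: twM.
  rewrite big_cat /= !big_map big_filter /= addrA.
  rewrite (eq_bigr (fun M => - a (M *m lam))) => [|M _]; last by rewrite mulN1r.
  rewrite sumrN [X in - X]hS /orbsum (bigID P) /= opprD addrA.
  rewrite (eq_bigr (fun=> b lam)) => [|M /asboolP e]; last by rewrite -{2}e.
  rewrite [X in _ + X](eq_bigr (fun M => b (M *m lam))) => [|M _]; last by rewrite mul1r.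
  by rewrite big_const_seq iter_addr_0 mulr_natl subrK subrr.
have : (0 < count P Ws)%N.
  rewrite -has_count; apply/hasP; exists 1%:M; first by apply/mW; apply: weyl1.
  by apply/asboolP/funext => lam; rewrite /tw mul1mx.
by case: (count _ _) => // k _ /char0.
Qed.

End Separation.

(** * The ring of Puiseux series *)

Section PuiseuxProduct.
Variable R : realType.
Implicit Types (f g h : puis R) (q r p : rat).

(** [pmul] is a finitely supported sum, which is zero by default on an infinite support. Any finite
    list covering the support evaluates it, so each computation can use a convenient one. *)
Lemma pmulE f g q (s : seq rat) : uniq s ->
  (forall r, f r != 0 -> g (q - r) != 0 -> r \in s) ->
  pmul f g q = \sum_(r <- s) f r * g (q - r).
Proof.
move=> us hs; rewrite /pmul (fsbig_seq _ _ us); apply/esym/fsbig_widen => // r [_ /= nr].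
apply/eqP; rewrite mulf_eq0; apply: contraT; rewrite negb_or => /andP[h1 h2].
by case: nr; rewrite /= hs.
Qed.

Lemma pmul_supp f g q : pmul f g q != 0 -> exists2 r, f r != 0 & g (q - r) != 0.
Proof.
move=> h; apply: contrapT => nex; case/eqP: h.
rewrite (pmulE (s := [::])) ?big_nil // => r fr gr.
by exfalso; apply: nex; exists r.
Qed.

(** Only the pair (p, p') can contribute to the exponent p + p'. Both are mere lower bounds: the
    coefficients there may vanish. *)
Lemma pmul_lead f g p p' :
  (forall q, f q != 0 -> p <= q) -> (forall q, g q != 0 -> p' <= q) ->
  pmul f g (p + p') = f p * g p' /\ forall q, pmul f g q != 0 -> p + p' <= q.
Proof.
move=> hf hg; split=> [|q /pmul_supp[r /hf h1 /hg h2]]; last first.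
  by rewrite -(subrK r q) addrC lerD.
rewrite (pmulE (s := [:: p])) // => [|r /hf h1 /hg h2].
  by rewrite big_seq1 addrAC subrr add0r.
by rewrite inE eq_le h1 andbT; move: h2; rewrite lerBrDr addrC lerD2r.
Qed.

Definition supp_in (N : nat) (m : int) f :=
  forall q, f q != 0 -> exists k : int, q = k%:~R / N%:R /\ m <= k.

Lemma supp_in_puis N m f : (0 < N)%N -> supp_in N m f -> is_puis f.
Proof. by exists N; split=> //; exists m. Qed.

Lemma supp_in_scale N N' m f : (0 < N)%N -> (0 < N')%N ->
  supp_in N m f -> supp_in (N * N') (m * N'%:Z) f.
Proof.
move=> N0 N0' hf q /hf[k [-> mk]]; exists (k * N'%:Z); split.
  rewrite intrM natrM -[N'%:Z%:~R]pmulrn; field.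
  by rewrite !pnatr_eq0 -!lt0n N0 N0'.
by rewrite ler_pM2r // ltz_nat.
Qed.

Lemma supp_in_le N m m' f : m' <= m -> supp_in N m f -> supp_in N m' f.
Proof. by move=> mm hf q /hf[k [-> mk]]; exists k; split=> //; apply: le_trans mk. Qed.

Lemma supp_in_common2 f g : is_puis f -> is_puis g ->
  exists N m, [/\ (0 < N)%N, supp_in N m f & supp_in N m g].
Proof.
move=> [N1 [N10 [m1 h1]]] [N2 [N20 [m2 h2]]].
exists (N1 * N2)%N, (Num.min (m1 * N2%:Z) (m2 * N1%:Z)); rewrite muln_gt0 N10 N20.
split=> //; first by apply: supp_in_le (supp_in_scale N10 N20 h1); rewrite ge_min lexx.
by rewrite mulnC; apply: supp_in_le (supp_in_scale N20 N10 h2); rewrite ge_min lexx orbT.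
Qed.

Lemma supp_in_common3 f g h : is_puis f -> is_puis g -> is_puis h ->
  exists N m, [/\ (0 < N)%N, supp_in N m f, supp_in N m g & supp_in N m h].
Proof.
move=> pf pg [N2 [N20 [m2 h2]]]; have [N1 [m1 [N10 hf hg]]] := supp_in_common2 pf pg.
exists (N1 * N2)%N, (Num.min (m1 * N2%:Z) (m2 * N1%:Z)); rewrite muln_gt0 N10 N20.
split=> //.
- by apply: supp_in_le (supp_in_scale N10 N20 hf); rewrite ge_min lexx.
- by apply: supp_in_le (supp_in_scale N10 N20 hg); rewrite ge_min lexx.
- by rewrite mulnC; apply: supp_in_le (supp_in_scale N20 N10 h2); rewrite ge_min lexx orbT.
Qed.

Lemma supp_in_mul N m m' f g : supp_in N m f -> supp_in N m' g ->
  supp_in N (m + m') (pmul f g).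
Proof.
move=> hf hg q /pmul_supp[r /hf[k [er mk]] /hg[k' [er' mk']]].
exists (k + k'); split; last exact: lerD.
by rewrite -(subrK r q) er' er intrD mulrDl addrC.
Qed.

Definition grid (N L : nat) : seq rat :=
  [seq (i%:Z - L%:Z)%:~R / N%:R | i <- iota 0 (2 * L).+1].

Lemma grid_uniq N L : (0 < N)%N -> uniq (grid N L).
Proof.
move=> N0; rewrite map_inj_uniq ?iota_uniq // => i j.
have n0 : N%:R != 0 :> rat by rewrite pnatr_eq0 -lt0n.
by move=> /(mulIf (invr_neq0 n0))/intr_inj/addIr[].
Qed.

Lemma grid_mem N L (k : int) : `|k| <= L%:Z -> k%:~R / N%:R \in grid N L.
Proof.
move=> hk; apply/mapP; exists (absz (k + L%:Z)%R); first by rewrite mem_iota; lia.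
by congr (_%:~R / _); lia.
Qed.

(** The total is fixed by q and each index is bounded below, so each is also bounded above by the
    total minus the other two bounds. *)
Lemma grid_bound N (m : int) q : (0 < N)%N -> exists L : nat, forall k1 k2 k3 : int,
  m <= k1 -> m <= k2 -> m <= k3 -> q = (k1 + k2 + k3)%:~R / N%:R ->
  `|k1| <= L%:Z /\ `|k1 + k2| <= L%:Z.
Proof.
move=> N0; exists (2 * absz m + Num.bound (`|q * N%:R|)%R)%N => k1 k2 k3 h1 h2 h3 e.
have n0 : N%:R != 0 :> rat by rewrite pnatr_eq0 -lt0n.
have := archi_boundP (normr_ge0 (q * N%:R)); set B := Num.bound _.
rewrite {1}e divfK // -intr_norm. rewrite [X in _ < X]pmulrn ltr_int.
by clearbody B; clear e; lia.
Qed.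

(** Both sides become the same double sum over one finite grid, which contains every first exponent
    u and every partial sum r that can contribute. *)
Lemma pmulA f g h : is_puis f -> is_puis g -> is_puis h ->
  pmul f (pmul g h) = pmul (pmul f g) h.
Proof.
move=> pf pg ph; apply/funext => q.
have [N [m [N0 hf hg hh]]] := supp_in_common3 pf pg ph.
have [L hL] := grid_bound m q N0; set G := grid N L.
have uG : uniq G by apply: grid_uniq.
have key u r : f u != 0 -> g (r - u) != 0 -> h (q - r) != 0 -> u \in G /\ r \in G.
  move=> /hf[k1 [e1 m1]] /hg[k2 [e2 m2]] /hh[k3 [e3 m3]].
  have er : r = (k1 + k2)%:~R / N%:R.
    by rewrite -(subrK u r) e2 e1 intrD mulrDl addrC.
  have eq : q = (k1 + k2 + k3)%:~R / N%:R.
    by rewrite -(subrK r q) e3 er (intrD _ (k1 + k2)) mulrDl addrC.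
  by have [b1 b2] := hL _ _ _ m1 m2 m3 eq; rewrite e1 er !grid_mem.
rewrite (pmulE uG) => [|u fu /pmul_supp[t gt ht]]; last first.
  by apply: (key u (t + u) _ _ _).1; rewrite ?addrK // [t + u]addrC opprD addrA.
rewrite (pmulE uG) => [|r /pmul_supp[u fu gu] hr]; last exact: (key u r _ _ _).2.
have -> : \sum_(r <- G) pmul f g r * h (q - r) =
    \sum_(r <- G) \sum_(u <- G) f u * g (r - u) * h (q - r).
  apply: eq_bigr => r _; rewrite -mulr_suml.
  have [->|hr] := eqVneq (h (q - r)) 0; first by rewrite !mulr0.
  by rewrite (pmulE uG) // => u fu gu; apply: (key u r _ _ _).1.
rewrite exchange_big; apply: eq_bigr => u _ /=.
have [->|fu] := eqVneq (f u) 0; first by rewrite mul0r big1 // => r _; rewrite !mul0r.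
rewrite (pmulE (s := [seq r - u | r <- G])).
- rewrite big_map mulr_sumr; apply: eq_bigr => r _.
  by rewrite mulrA; congr (_ * h _); rewrite opprB addrA subrK.
- by rewrite map_inj_uniq // => x y /addIr.
- move=> t gt ht; apply/mapP; exists (t + u); rewrite ?addrK //.
  by apply: (key u (t + u) _ _ _).2; rewrite ?addrK // [t + u]addrC opprD addrA.
Qed.

Lemma pmul_cover f g q : is_puis f -> is_puis g ->
  exists2 s, uniq s & forall r, f r != 0 -> g (q - r) != 0 -> r \in s.
Proof.
move=> pf pg; have [N [m [N0 hf hg]]] := supp_in_common2 pf pg.
(* With two factors the third index is a dummy 0, which the lower bound [Num.min m 0] admits. *)
have [L hL] := grid_bound (Num.min m 0) q N0; exists (grid N L); first exact: grid_uniq.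
move=> r /hf[k1 [e1 m1]] /hg[k2 [e2 m2]].
have [] // := hL k1 k2 0; try lia; last by rewrite e1 => ? _; apply: grid_mem.
by rewrite addr0 -(subrK r q) e2 e1 intrD mulrDl addrC.
Qed.

Lemma pmulC f g : is_puis f -> is_puis g -> pmul f g = pmul g f.
Proof.
move=> pf pg; apply/funext => q; have [s us hs] := pmul_cover q pf pg.
rewrite (pmulE us hs) (pmulE (s := [seq q - r | r <- s])).
- by rewrite big_map; apply: eq_bigr => r _; rewrite subKr mulrC.
- by rewrite map_inj_uniq // => x y /addrI/oppr_inj.
- move=> r gr fr; apply/mapP; exists (q - r); rewrite ?subKr //.
  by apply: hs; rewrite ?subKr.
Qed.

Lemma pmul1 f : pmul (@pone R) f = f.
Proof.
apply/funext => q; rewrite (pmulE (s := [:: 0])) // => [|r].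
  by rewrite big_seq1 /pone eqxx mul1r subr0.
by rewrite /pone inE; case: (r == 0) => //; rewrite eqxx.
Qed.

Lemma pmulDl f g h : is_puis f -> is_puis g -> is_puis h ->
  pmul (fun q => f q + g q) h = fun q => pmul f h q + pmul g h q.
Proof.
move=> pf pg ph; apply/funext => q.
have [s us hs] := pmul_cover q pf ph; have [t ut ht] := pmul_cover q pg ph.
have uu : uniq (undup (s ++ t)) by apply: undup_uniq.
have hu r : (r \in undup (s ++ t)) = (r \in s) || (r \in t) by rewrite mem_undup mem_cat.
rewrite (@pmulE f h q _ uu) => [|r fr hr]; last by rewrite hu hs.
rewrite (@pmulE g h q _ uu) => [|r gr hr]; last by rewrite hu ht ?orbT.
rewrite (pmulE uu) => [|r fgr hr].
  by rewrite -big_split; apply: eq_bigr => r _ /=; rewrite mulrDl.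
rewrite hu; have [fr|fr] := eqVneq (f r) 0; last by rewrite hs.
by rewrite fr add0r in fgr; rewrite ht ?orbT.
Qed.

Lemma is_puis0 : is_puis (fun=> 0 : R[i]).
Proof. by exists 1%N; split=> //; exists 0 => q; rewrite eqxx. Qed.

Lemma is_puis1 : is_puis (@pone R).
Proof.
exists 1%N; split=> //; exists 0 => q; rewrite /pone; have [-> _|_] := eqVneq q 0; last first.
  by rewrite eqxx.
by exists 0; rewrite mul0r.
Qed.

Lemma is_puisD f g : is_puis f -> is_puis g -> is_puis (fun q => f q + g q).
Proof.
move=> pf pg; have [N [m [N0 hf hg]]] := supp_in_common2 pf pg.
apply: (supp_in_puis (m := m) N0) => q; have [fq|fq _] := eqVneq (f q) 0; last exact: hf.
by rewrite fq add0r; apply: hg.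
Qed.

Lemma is_puisN f : is_puis f -> is_puis (fun q => - f q).
Proof.
by move=> [N [N0 [m hf]]]; exists N; split=> //; exists m => q; rewrite oppr_eq0; apply: hf.
Qed.

Lemma is_puisM f g : is_puis f -> is_puis g -> is_puis (pmul f g).
Proof.
move=> pf pg; have [N [m [N0 hf hg]]] := supp_in_common2 pf pg.
exact: supp_in_puis N0 (supp_in_mul hf hg).
Qed.

Lemma puis_lead f : is_puis f -> f <> (fun=> 0) ->
  exists2 p, f p != 0 & forall q, f q != 0 -> p <= q.
Proof.
move=> [N [N0 [m hf]]] nz.
have n0 : 0 < N%:R :> rat by rewrite ltr0n.
have ex : exists i : nat, f ((m + i%:Z)%:~R / N%:R) != 0.
  apply: contrapT => nex; apply: nz; apply/funext => q; apply/eqP; apply: contraT => fq.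
  have [k [e mk]] := hf q fq; exfalso; apply: nex; exists `|k - m|%N.
  by rewrite (_ : m + _ = k) -?e //; lia.
case: (ex_minnP ex) => i fi mini; exists ((m + i%:Z)%:~R / N%:R) => // q fq.
have [k [e mk]] := hf q fq.
have : (i <= `|k - m|)%N by apply: mini; rewrite (_ : m + _ = k) -?e //; lia.
by move=> ik; rewrite e ler_pM2r ?invr_gt0 // ler_int; lia.
Qed.

End PuiseuxProduct.

(** * Puiseux series as a commutative domain of characteristic zero *)

Record puiseux (R : realType) :=
  Puiseux { pval :> puis R; _ : `[< is_puis pval >] }.

HB.instance Definition _ (R : realType) := [isSub for @pval R].
HB.instance Definition _ (R : realType) := [Choice of puiseux R by <:].

Section PuiseuxRing.
Variable R : realType.
Implicit Types x y z : puiseux R.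

Lemma pvalP x : is_puis x. Proof. exact/asboolP/(valP x). Qed.

Definition mkpuis (f : puis R) (hf : is_puis f) : puiseux R := Puiseux (asboolT hf).
Definition puis_zero := mkpuis (is_puis0 R).
Definition puis_one := mkpuis (is_puis1 R).
Definition puis_add x y := mkpuis (is_puisD (pvalP x) (pvalP y)).
Definition puis_opp x := mkpuis (is_puisN (pvalP x)).
Definition puis_mul x y := mkpuis (is_puisM (pvalP x) (pvalP y)).

Lemma puis_addA : associative puis_add.
Proof. by move=> x y z; apply/val_inj/funext => q /=; rewrite addrA. Qed.
Lemma puis_addC : commutative puis_add.
Proof. by move=> x y; apply/val_inj/funext => q /=; rewrite addrC. Qed.
Lemma puis_add0 : left_id puis_zero puis_add.
Proof. by move=> x; apply/val_inj/funext => q /=; rewrite add0r. Qed.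
Lemma puis_addN : left_inverse puis_zero puis_opp puis_add.
Proof. by move=> x; apply/val_inj/funext => q /=; rewrite addNr. Qed.

HB.instance Definition _ :=
  GRing.isZmodule.Build (puiseux R) puis_addA puis_addC puis_add0 puis_addN.

Lemma puis_mulA : associative puis_mul.
Proof. by move=> x y z; apply/val_inj/pmulA; apply: pvalP. Qed.
Lemma puis_mulC : commutative puis_mul.
Proof. by move=> x y; apply/val_inj/pmulC; apply: pvalP. Qed.
Lemma puis_mul1 : left_id puis_one puis_mul.
Proof. by move=> x; apply/val_inj/pmul1. Qed.
Lemma puis_mulD : left_distributive puis_mul +%R.
Proof. by move=> x y z; apply/val_inj/pmulDl; apply: pvalP. Qed.
Lemma puis_one_neq0 : puis_one != 0.
Proof.
apply/eqP => /(congr1 (fun x => pval x 0)) /= /eqP.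
by rewrite /pone eqxx oner_eq0.
Qed.

HB.instance Definition _ := GRing.Zmodule_isComNzRing.Build (puiseux R)
  puis_mulA puis_mulC puis_mul1 puis_mulD puis_one_neq0.

Lemma pval_natr (k : nat) : pval (k%:R : puiseux R) 0 = k%:R.
Proof.
elim: k => [//|k IH]; rewrite mulrS [RHS]mulrS -IH.
by rewrite [LHS]/= /pone eqxx.
Qed.

Lemma puiseux_char0 (k : nat) : k.+1%:R <> 0 :> puiseux R.
Proof.
move=> /(congr1 (fun x => pval x 0)); rewrite pval_natr => /eqP.
by rewrite pnatr_eq0.
Qed.

Lemma puiseux_dom (x y : puiseux R) : x * y = 0 -> x = 0 \/ y = 0.
Proof.
move=> xy; apply: contrapT => /not_orP[x0 y0].
have [|p xp hp] := puis_lead (pvalP x); first by move=> e; apply: x0; apply/val_inj.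
have [|p' yp hp'] := puis_lead (pvalP y); first by move=> e; apply: y0; apply/val_inj.
have [+ _] := pmul_lead hp hp'; have -> : pmul x y = pval (x * y) by [].
rewrite xy /= => /esym/eqP; rewrite mulf_eq0.
by rewrite (negbTE xp) (negbTE yp).
Qed.

(** Applied to Omega: when a(al) has no negative exponents for any root al, val Omega = 0 means that
    no constant term of 1 - a(al) vanishes. *)
Lemma pval_prod_lead (I : eqType) (r : seq I) (F : I -> puiseux R) :
  (forall i, i \in r -> forall q, pval (F i) q != 0 -> 0 <= q) ->
  pval (\prod_(i <- r) F i) 0 = \prod_(i <- r) pval (F i) 0 /\
  forall q, pval (\prod_(i <- r) F i) q != 0 -> 0 <= q.
Proof.
elim: r => [|i r IH] h.
  rewrite !big_nil /= /pone eqxx; split=> // q.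
  by have [->|] := eqVneq q 0; rewrite ?eqxx.
have [IH1 IH2] := IH (fun j jr => h j (mem_behead (s := i :: r) jr)).
have [e1 e2] := pmul_lead (h i (mem_head _ _)) IH2.
by rewrite !big_cons -IH1 -e1 addr0; split=> // q /e2; rewrite addr0.
Qed.

End PuiseuxRing.

(** * The affine Weyl group and the alcove *)

Section RealPairing.
Variables (R : realType) (n : nat).
Implicit Types (lam mu v : 'cV[int]_n) (x y : 'cV[R]_n) (M : 'M[int]_n).
Local Notation ir := (map_mx (intr : int -> R)).

Lemma pairRE lam x : pairR lam x = ((ir lam)^T *m x) 0 0.
Proof. by rewrite mxE; apply: eq_bigr => k _; rewrite !mxE. Qed.

Lemma pairR_mull M lam x : pairR (M *m lam) x = pairR lam (ir M^T *m x).
Proof. by rewrite !pairRE map_mxM trmx_mul -[ir M^T]map_trmx mulmxA. Qed.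

Lemma pairRDr lam x y : pairR lam (x + y) = pairR lam x + pairR lam y.
Proof. by rewrite !pairRE mulmxDr mxE. Qed.

Lemma pairRZr lam c x : pairR lam (c *: x) = c * pairR lam x.
Proof. by rewrite !pairRE -scalemxAr mxE. Qed.

Lemma pairRNr lam x : pairR lam (- x) = - pairR lam x.
Proof. by rewrite -scaleN1r pairRZr mulN1r. Qed.

Lemma pairRBr lam x y : pairR lam (x - y) = pairR lam x - pairR lam y.
Proof. by rewrite pairRDr pairRNr. Qed.

Lemma pairR0r lam : pairR lam (0 : 'cV[R]_n) = 0.
Proof. by rewrite -(scale0r 0) pairRZr mul0r. Qed.

Lemma pairRDl lam mu x : pairR (lam + mu) x = pairR lam x + pairR mu x.
Proof. by rewrite !pairRE map_mxD linearD mulmxDl mxE. Qed.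

Lemma pairRZl c lam x : pairR (c *: lam) x = c%:~R * pairR lam x.
Proof. by rewrite !pairRE map_mxZ linearZ -scalemxAl mxE. Qed.

Lemma pairRNl lam x : pairR (- lam) x = - pairR lam x.
Proof. by rewrite -scaleN1r pairRZl mulN1r. Qed.

Lemma pairRBl lam mu x : pairR (lam - mu) x = pairR lam x - pairR mu x.
Proof. by rewrite pairRDl pairRNl. Qed.

Lemma pairR0l x : pairR 0 x = 0.
Proof. by rewrite -(scale0r 0) pairRZl mul0r. Qed.

Lemma pairR_suml (I : Type) (r : seq I) (P : pred I) (F : I -> 'cV_n) x :
  pairR (\sum_(i <- r | P i) F i) x = \sum_(i <- r | P i) pairR (F i) x.
Proof.
by apply: (big_morph (fun lam => pairR lam x) _ (pairR0l x)) => a b; rewrite pairRDl.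
Qed.

Lemma pairR_sumr (I : Type) (r : seq I) (P : pred I) (F : I -> 'cV[R]_n) lam :
  pairR lam (\sum_(i <- r | P i) F i) = \sum_(i <- r | P i) pairR lam (F i).
Proof.
by apply: (big_morph (fun x => pairR lam x) _ (pairR0r lam)) => a b; rewrite pairRDr.
Qed.

Lemma pairR_int lam v : pairR lam (ir v) = (pairZ lam v)%:~R.
Proof. by rewrite rmorph_sum; apply: eq_bigr => k _; rewrite mxE rmorphM. Qed.

Lemma pairR_evec (k : 'I_n) x : pairR (evec n k) x = x k 0.
Proof.
rewrite /pairR (bigD1 k) //= mxE eqxx mul1r big1 ?addr0 // => j jk.
by rewrite mxE (inj_eq val_inj) (negbTE jk) mul0r.
Qed.

Lemma pairR_extr x y : (forall lam, pairR lam x = pairR lam y) -> x = y.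
Proof. by move=> e; apply/matrixP => k j; rewrite ord1 -!pairR_evec e. Qed.

End RealPairing.

Lemma exists_small (F : realFieldType) (T : eqType) (r : seq T) (P : T -> F -> Prop) :
  (forall i, i \in r -> exists2 d, 0 < d & P i d) ->
  (forall i d d', 0 < d' <= d -> P i d -> P i d') ->
  exists2 d, 0 < d & forall i, i \in r -> P i d.
Proof.
move=> h mon; elim: r h => [|i r IH] h; first by exists 1.
have [|d d0 hd] := IH; first by move=> j jr; apply: h; rewrite inE jr orbT.
have [e e0 he] := h i (mem_head _ _).
exists (Num.min d e) => [|j]; first by rewrite lt_min d0 e0.
rewrite inE => /orP[/eqP->|jr].
  by apply: mon he; rewrite lt_min d0 e0 ge_min lexx orbT.
by apply: mon (hd j jr); rewrite lt_min d0 e0 ge_min lexx.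
Qed.

Lemma dist_int_gt0 (R : realType) (x : R) : (forall m : int, x != m%:~R) ->
  exists2 d, 0 < d & forall m : int, d <= `|x - m%:~R|.
Proof.
move=> hx; set k := Num.floor x.
have k1 : k%:~R < x by rewrite lt_neqAle eq_sym hx floor_le_tmp.
have k2 : x < (k + 1)%:~R by apply: lt_succ_floor.
exists (Num.min (x - k%:~R) ((k + 1)%:~R - x)) => [|m].
  by rewrite lt_min !subr_gt0 k1 k2.
rewrite ge_min; have [mk|km] := leP m k; apply/orP; [left|right].
  have : m%:~R <= k%:~R :> R by rewrite ler_int.
  by move=> h; rewrite ger0_norm; lra.
have : (k + 1)%:~R <= m%:~R :> R by rewrite ler_int; lia.
by move=> h; rewrite distrC ger0_norm; lra.
Qed.

Section Alcove.
Variable R : realType.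
Variables (n l : nat) (roots : seq 'cV[int]_n) (coroot : 'cV[int]_n -> 'cV[int]_n).
Variable simple : 'I_l -> 'cV[int]_n.
Hypothesis hRD : root_datum_hyp roots coroot simple.
Implicit Types (al be lam mu t : 'cV[int]_n) (w M N : 'M[int]_n) (x y v : 'cV[R]_n).

Local Notation s al := (refl al (coroot al)).
Local Notation W := (weyl roots coroot).
Local Notation pos := (posroot roots simple).
Local Notation ir := (map_mx (intr : int -> R)).
Local Notation rho := (rhov roots coroot simple).
Local Notation C := (@alcove R n l roots simple).

Lemma dual_cow (F : comUnitRingType) w : W w ->
  invmx (map_mx (fun z : int => z%:~R : F) w)^T = map_mx intr (cow w).
Proof.
move=> Ww; rewrite -[X in invmx X]/(map_mx (intr : int -> F) w)^T; set A := (_)^T.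
have e : A *m map_mx intr (cow w) = 1%:M.
  rewrite /A map_trmx -(map_mxM (intr : int -> F)) /cow -trmx_mul mulVmx ?(weyl_unit hRD) //.
  by rewrite trmx1 map_mx1.
have [uA _] := mulmx1_unit e.
by rewrite -[LHS]mulmx1 -e mulmxA mulVmx // mul1mx.
Qed.

Definition rcow w : 'M[R]_n := ir (cow w).

Lemma dualRE w : W w -> dualR R w = rcow w.
Proof. exact: dual_cow. Qed.

Lemma rcow1 : rcow 1%:M = 1%:M. Proof. by rewrite /rcow cow1 map_mx1. Qed.

Lemma rcowM M N : W M -> W N -> rcow (M *m N) = rcow M *m rcow N.
Proof. by move=> WM WN; rewrite /rcow (cowM hRD) // map_mxM. Qed.

Lemma rcow_int w t : rcow w *m ir t = ir (cow w *m t).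
Proof. by rewrite map_mxM. Qed.

Lemma pairR_rcow w lam x : W w -> pairR (w *m lam) (rcow w *m x) = pairR lam x.
Proof.
move=> Ww; rewrite pairR_mull mulmxA -map_mxM /cow -trmx_mul mulVmx ?(weyl_unit hRD) //.
by rewrite trmx1 map_mx1 mul1mx.
Qed.

Lemma pairR_rcowV w lam x : W w -> pairR lam (rcow w *m x) = pairR (invmx w *m lam) x.
Proof.
by move=> Ww; rewrite -(pairR_rcow _ x Ww) mulKVmx // (weyl_unit hRD).
Qed.

Lemma rcow_refl al x : al \in roots ->
  rcow (s al) *m x = x - pairR al x *: ir (coroot al).
Proof.
move=> ha; apply: pairR_extr => lam; rewrite /rcow (cow_refl hRD) // crefl_tr.
rewrite -pairR_mull reflE pairRBl pairRZl pairRBr pairRZr pairR_int.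
by rewrite mulrC.
Qed.

Lemma rcow_coord w x (k : 'I_n) : W w -> (l <= k)%N -> (rcow w *m x) k 0 = x k 0.
Proof.
move=> Ww lk; elim/(weyl_ind (roots := roots) (coroot := coroot)): w / Ww => [|al M ha WM IH].
  by rewrite rcow1 mul1mx.
rewrite rcowM //; last exact: (weyl_refl coroot ha).
rewrite -mulmxA rcow_refl // mxE [X in _ + X]mxE [X in - X]mxE [X in _ * X]mxE.
by rewrite (coroot_coord_ge hRD) // mulr0 subr0.
Qed.

Lemma rcow_fix w x : W w -> (forall al, al \in roots -> pairR al x = 0) -> rcow w *m x = x.
Proof.
move=> Ww hx; elim/(weyl_ind (roots := roots) (coroot := coroot)): w / Ww => [|al M ha WM IH].
  by rewrite rcow1 mul1mx.
rewrite rcowM //; last exact: (weyl_refl coroot ha).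
by rewrite -mulmxA IH rcow_refl // hx // scale0r subr0.
Qed.

Lemma rcow_inv w x : W w -> rcow (invmx w) *m (rcow w *m x) = x.
Proof.
move=> Ww; rewrite mulmxA -rcowM //; last exact: (weyl_inv hRD).
by rewrite mulVmx ?(weyl_unit hRD) // rcow1 mul1mx.
Qed.

Lemma pairR_comb c x : pairR (simple_comb simple c) x = \sum_i (c i)%:~R * pairR (simple i) x.
Proof. by rewrite pairR_suml; apply: eq_bigr => i _; rewrite pairRZl. Qed.

(** Irreducible components are never formed: a positive root that is not maximal lies below a higher
    one, and heights are bounded. *)
Lemma highest_above al : pos al ->
  exists2 be, highest_root roots simple be & dom_le simple al be.
Proof.
pose B : int := \sum_(g <- roots) `|pairZ g rho|.
have hB g : pos g -> pairZ g rho <= B.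
  move=> /pos_root hg; apply: (le_trans (ler_norm _)); rewrite /B (big_rem g) //=.
  by rewrite lerDl; apply: sumr_ge0.
have [k hk] : exists k : nat, B - pairZ al rho <= k%:Z.
  by exists `|B - pairZ al rho|%N; lia.
elim: k al hk => [|k IH] al hk pa.
  exists al; last exact: dle_refl.
  split=> // g pg ag; have [l1 l2] := dle_rhov hRD ag.
  by apply/esym/l2; have := hB g pg; lia.
have [hh|nh] := pselect (highest_root roots simple al).
  by exists al => //; apply: dle_refl.
have [g [pg [ag ga]]] : exists g, pos g /\ dom_le simple al g /\ g <> al.
  apply: contrapT => nex; apply: nh; split=> // g pg ag.
  by apply: contrapT => ga; apply: nex; exists g.
have [l1 l2] := dle_rhov hRD ag.
have ne : pairZ al rho <> pairZ g rho by move=> /l2 e; apply: ga.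
have [|be hb gb] := IH g _ pg; first by move: (pairZ al rho) (pairZ g rho) l1 ne hk => p q; lia.
by exists be => //; apply: dle_trans gb.
Qed.

(** Together with [alcoveP] this replaces the conditions on simple and highest roots by one that is
    uniform in the positive roots, hence easy to transport by W. *)
Lemma alcove_pos v al : C v -> pos al -> 0 < pairR al v < 1.
Proof.
move=> [h1 h2] pa.
have nn c : (forall i, 0 <= c i) -> 0 <= pairR (simple_comb simple c) v.
  move=> c0; rewrite pairR_comb; apply: sumr_ge0 => i _.
  by rewrite mulr_ge0 ?ler0z // ltW.
apply/andP; split.
  have [c [e c0]] := posP pa; rewrite lt_neqAle e nn // andbT eq_sym.
  apply/negP; rewrite pairR_comb psumr_eq0 => [/allP hz|i _]; last first.
    by rewrite mulr_ge0 ?ler0z // ltW.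
  have := root_neq0 hRD (pos_root pa); rewrite e /simple_comb big1 ?eqxx // => i _.
  have := hz i (mem_index_enum _); rewrite mulf_eq0 intr_eq0 (negbTE (lt0r_neq0 (h1 i))) orbF.
  by move=> /eqP->; rewrite scale0r.
have [be hb [c [e c0]]] := highest_above pa; apply: le_lt_trans (h2 _ hb).
by rewrite -subr_ge0 -pairRBl e nn.
Qed.

Lemma alcoveP v : (forall al, pos al -> 0 < pairR al v < 1) -> C v.
Proof.
move=> h; split=> [i|be [pb _]]; first by have /andP[] := h _ (pos_simple hRD i).
by have /andP[] := h _ pb.
Qed.

Lemma alcove_eq v v' : C v -> (forall al, al \in roots -> pairR al v' = pairR al v) -> C v'.
Proof.
by move=> Cv e; apply: alcoveP => al pa; rewrite e ?(pos_root pa) //; apply: alcove_pos.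
Qed.

Lemma alcove_neg v al : C v -> pos (- al) -> -1 < pairR al v < 0.
Proof. by move=> Cv /(alcove_pos Cv); rewrite pairRNl; lra. Qed.

Lemma alcove_nonempty : exists v, C v.
Proof.
pose B : R := 1 + \sum_(g <- roots) `|(pairZ g rho)%:~R|.
have B0 : 0 < B by rewrite ltr_pwDl // sumr_ge0.
exists (B^-1 *: ir rho); apply: alcoveP => al pa.
rewrite pairRZr pairR_int mulr_gt0 ?invr_gt0 ?ltr0z ?(pos_rhov hRD) //=.
rewrite mulrC ltr_pdivrMr // mul1r (le_lt_trans (ler_norm _)) // /B.
rewrite (big_rem al) ?(pos_root pa) //= addrCA ltrDl ltr_pwDl // sumr_ge0 //.
Qed.

(* An affine Weyl element taking one point of the alcove to the alcove takes
   the whole alcove to itself: for a positive root al, [pairR al (rcow w *m v)]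
   lies in (0,1) or in (-1,0) according to the sign of w^-1 al, whichever the
   point v of the alcove. *)
Lemma alcove_stab_sub w t v v' : W w -> C v -> C (rcow w *m v + ir t) -> C v' ->
  C (rcow w *m v' + ir t).
Proof.
move=> Ww Cv Cw Cv'; apply: alcoveP => al pa; have := alcove_pos Cw pa.
rewrite !pairRDr !pairR_rcowV // pairR_int.
have hb := weyl_root hRD (weyl_inv hRD Ww) (pos_root pa).
set m := pairZ al t; set be := invmx w *m al in hb *.
have [pb|pb] := pos_or_neg hRD hb.
  have := alcove_pos Cv pb; have := alcove_pos Cv' pb => h1 h2 h3.
  have : m%:~R < 1%:~R :> R by lra.
  have : (-1)%:~R < m%:~R :> R by lra.
  rewrite !ltr_int => m1 m2; have -> : m = 0 by lia.
  lra.
have := alcove_neg Cv pb; have := alcove_neg Cv' pb => h1 h2 h3.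
have : m%:~R < 2%:~R :> R by lra.
have : 0%:~R < m%:~R :> R by lra.
rewrite !ltr_int => m1 m2; have -> : m = 1 by lia.
lra.
Qed.

(** The inverse affine map, with translation [t'], also takes a point of the alcove into the alcove,
    so the inclusion holds in both directions. *)
Lemma alcove_stab w t v : W w -> C v -> C (rcow w *m v + ir t) ->
  (fun x => rcow w *m x + ir t) @` C = C.
Proof.
move=> Ww Cv Cw; apply/seteqP; split=> [_ [x Cx <-]|x Cx].
  exact: alcove_stab_sub Cv Cw Cx.
have Wi := weyl_inv hRD Ww.
pose t' := - (cow (invmx w) *m t).
have e y : rcow (invmx w) *m (y - ir t) = rcow (invmx w) *m y + ir t'.
  by rewrite mulmxBr rcow_int map_mxN.
exists (rcow (invmx w) *m (x - ir t)).
  rewrite e; apply: (alcove_stab_sub Wi Cw _ Cx).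
  by rewrite -e addrK rcow_inv.
have := rcow_inv (x - ir t) Wi; rewrite invmxK => ->.
by rewrite subrK.
Qed.

(** The W-invariant semidefinite form on a with radical a_G; on a difference of two points it is a
    squared distance modulo a_G. *)
Definition bform x y : R := \sum_(al <- roots) pairR al x * pairR al y.

Lemma bform_refl al x y : al \in roots ->
  bform (rcow (s al) *m x) (rcow (s al) *m y) = bform x y.
Proof.
move=> ha; rewrite /bform -[RHS](perm_big _ (perm_roots_refl hRD ha)) /= big_map.
apply: eq_bigr => be _; have Ws := weyl_refl coroot ha.
rewrite !pairR_rcowV // (_ : invmx (s al) = s al) //.
by rewrite -[LHS]mulmx1 -(reflK hRD ha) mulKmx // (weyl_unit hRD).
Qed.

Lemma bform_coroot al x : al \in roots ->
  2 * bform (ir (coroot al)) x = pairR al x * bform (ir (coroot al)) (ir (coroot al)).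
Proof.
move=> ha; have := bform_refl (ir (coroot al)) x ha.
rewrite !rcow_refl // pairR_int (pair_coroot hRD) //.
have bl (a : R) z z' : bform (a *: ir (coroot al)) (z + z') =
    a * bform (ir (coroot al)) z + a * bform (ir (coroot al)) z'.
  rewrite /bform !mulr_sumr -big_split; apply: eq_bigr => be _ /=.
  by rewrite pairRZr pairRDr; ring.
have bn z (a : R) : bform z (- (a *: ir (coroot al))) = - a * bform z (ir (coroot al)).
  by rewrite /bform mulr_sumr; apply: eq_bigr => be _; rewrite pairRNr pairRZr; ring.
have -> : ir (coroot al) - 2%:~R *: ir (coroot al) = (-1) *: ir (coroot al).
  by rewrite -[X in X - _]scale1r -scalerBl; congr (_ *: _); lra.
rewrite bl bn; lra.
Qed.

Lemma bform_coroot_ge al : al \in roots -> 4 <= bform (ir (coroot al)) (ir (coroot al)).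
Proof.
move=> ha; rewrite /bform (big_rem al) //= pairR_int (pair_coroot hRD) //.
have : 0 <= \sum_(y <- rem al roots) pairR y (ir (coroot al)) * pairR y (ir (coroot al)).
  by apply: sumr_ge0 => g _; rewrite -expr2 sqr_ge0.
lra.
Qed.

(* Here y is the reflection of x in the hyperplane al = k: it is closer to x0
   than x is when the hyperplane separates x from x0. *)
Lemma bform_affine_refl al k x x0 : al \in roots ->
  let y := x - (pairR al x - k) *: ir (coroot al) in
  bform (y - x0) (y - x0) = bform (x - x0) (x - x0) +
    bform (ir (coroot al)) (ir (coroot al)) * (pairR al x - k) * (pairR al x0 - k).
Proof.
move=> ha y; set a := pairR al x - k; set v := ir (coroot al).
have -> : y - x0 = (x - x0) - a *: v by rewrite addrAC.
have bb z : bform (z - a *: v) (z - a *: v) = bform z z - a * (2 * bform v z) + a ^+ 2 * bform v v.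
  rewrite /bform !mulr_sumr -sumrB -big_split /=; apply: eq_bigr => be _.
  by rewrite !(pairRBr, pairRZr); ring.
rewrite bb bform_coroot // pairRBr -/v /a; ring.
Qed.

(** The vanishing coordinates say that t is in Q(R^v), so that (w, t) is in the affine Weyl group
    and moving by it does not change the class of nu. *)
Definition reaches y := exists w t,
  [/\ W w, forall k : 'I_n, (l <= k)%N -> t k 0 = 0 & C (rcow w *m y + ir t)].

Lemma reaches_affine_refl al (k : int) y : al \in roots ->
  reaches (y - (pairR al y - k%:~R) *: ir (coroot al)) -> reaches y.
Proof.
move=> ha [w [t [Ww t0 Cw]]]; have Ws := weyl_refl coroot ha.
exists (w *m s al), (cow w *m (k *: coroot al) + t); split; first exact: weyl_mul.
  move=> j lj; rewrite mxE t0 // (cow_coord hRD) // mxE (coroot_coord_ge hRD) //.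
  by rewrite mulr0 addr0.
rewrite rcowM // -mulmxA rcow_refl // map_mxD -rcow_int map_mxZ addrA -mulmxDr.
by move: Cw; rewrite scalerBl opprB addrA addrAC.
Qed.

(** Descent on the squared distance to a point x0 of the alcove: while y is outside, a wall
    separates it from x0, and reflecting in it brings y closer. The drop is uniform. The lower bound
    d for the distance of the root values of y to the integers survives affine reflections, x0 has
    distance at least b from the walls used, and a coroot has norm at least 4; hence 4 * d * b. *)
Lemma regular_reaches y : (forall al, al \in roots -> forall m : int, pairR al y != m%:~R) ->
  reaches y.
Proof.
move=> reg.
have [d d0 hd] : exists2 d : R, 0 < d &
    forall al, al \in roots -> forall m : int, d <= `|pairR al y - m%:~R|.
  apply: exists_small => [al ha|al d d' /andP[_ dd] h m]; last exact: le_trans (h m).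
  by apply: dist_int_gt0 => m; apply: reg.
have [x0 Cx0] := alcove_nonempty.
have [b b0 hb] : exists2 b : R, 0 < b &
    forall al, al \in roots -> pos al -> b <= pairR al x0 /\ b <= 1 - pairR al x0.
  apply: exists_small => [al ha|al e e' /andP[_ ee] h pa]; last first.
    by have [h1 h2] := h pa; split; lra.
  have [/(alcove_pos Cx0)/andP[h1 h2]|np] := pselect (pos al); last by exists 1.
  exists (Num.min (pairR al x0) (1 - pairR al x0)).
    by rewrite lt_min h1 subr_gt0 h2.
  by rewrite !ge_min !lexx orbT.
pose c := 4 * d * b; have c0 : 0 < c by rewrite !mulr_gt0.
have [N hN] : exists N : nat, bform (y - x0) (y - x0) < N%:R * c.
  exists (Num.bound `|bform (y - x0) (y - x0) / c|).
  rewrite -ltr_pdivrMr //; apply: le_lt_trans (ler_norm _) _.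
  exact: archi_boundP.
elim: N y {reg} hd hN => [|N IH] y hd hN.
  move: hN; rewrite mul0r ltNge => /negP[]; apply: sumr_ge0 => al _.
  by rewrite -expr2 sqr_ge0.
have [Cy|nC] := pselect (C y).
  by exists 1%:M, 0; split; [exact: weyl1 | move=> k _; rewrite mxE |
    rewrite rcow1 mul1mx map_mx0 addr0].
(* A failing simple root gives the wall where it is 0. A failing highest root be gives the wall be =
   1, written with al = - be and k = -1 so that x0 is above k in both cases. *)
have [al [k [ha bk ak]]] : exists al (k : int),
    [/\ al \in roots, b <= pairR al x0 - k%:~R & pairR al y <= k%:~R].
  have [/existsNP[i hi]|h1] := pselect (~ forall i, 0 < pairR (simple i) y).
    exists (simple i), 0; have hs := simple_root hRD i; split=> //.
      by rewrite subr0; have [] := hb _ hs (pos_simple hRD i).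
    by rewrite leNgt; apply/negP.
  have [be /not_implyP[hbe nb]] : exists be, ~ (highest_root roots simple be -> pairR be y < 1).
    apply/existsNP => h2; apply: nC; split=> //.
    exact: contrapT h1.
  have pb : pos be by case: hbe.
  exists (- be), (-1); split; first exact: (root_opp hRD (pos_root pb)).
    by rewrite pairRNl; have [_ ] := hb be (pos_root pb) pb; lra.
  by move: nb; rewrite pairRNl => /negP; rewrite -leNgt; lra.
apply: (reaches_affine_refl (k := k) ha); apply: IH => [be hbe m|].
  have -> : y - (pairR al y - k%:~R) *: ir (coroot al) = rcow (s al) *m y + k%:~R *: ir (coroot al).
    by rewrite rcow_refl // scalerBl opprB addrA addrAC.
  rewrite pairRDr pairRZr pairR_int pairR_rcowV; last exact: (weyl_refl coroot ha).
  have hib := weyl_root hRD (weyl_inv hRD (weyl_refl coroot ha)) hbe.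
  apply: (le_trans (hd _ hib (m - k * pairZ be (coroot al)))).
  by rewrite intrB intrM opprB addrA addrAC.
rewrite bform_affine_refl //; set B := bform (ir _) _.
have B4 : 4 <= B by apply: bform_coroot_ge.
have ad : pairR al y - k%:~R <= - d.
  have := hd _ ha k; rewrite ler0_norm; first lra.
  by rewrite subr_le0.
set a := pairR al y - _ in ad *; set e := pairR al x0 - _ in bk *.
have : B * a * e <= - c.
  rewrite -lerN2 opprK -mulNr -mulrN /c.
  apply: ler_pM => //; first by rewrite mulr_ge0 // ltW.
    exact: ltW.
  by apply: ler_pM => //; [exact: ltW | lra].
rewrite mulrS mulrDl mul1r in hN.
lra.
Qed.

End Alcove.

(** * Polar coordinates *)

Section Polar.
Variable R : realType.
Implicit Types x y : R.

(** Angles are measured in turns, so that their ambiguity is Z, and that of the argument of a torus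
    point is X_*(A). *)
Definition polar y x : R[i] :=
  Complex (expR y * cos (2 * pi * x)) (expR y * sin (2 * pi * x)).

Lemma expi_polar x : expi (2 * pi * x) = polar 0 x.
Proof. by rewrite /polar expR0 !mul1r. Qed.

Lemma polarD y y' x x' : polar (y + y') (x + x') = polar y x * polar y' x'.
Proof.
rewrite /polar expRD mulrDr cosD sinD; apply/eqP; rewrite eq_complex /=.
by apply/andP; split; apply/eqP; ring.
Qed.

Lemma polar00 : polar 0 0 = 1.
Proof. by rewrite -expi_polar /expi mulr0 cos0 sin0. Qed.

Lemma polar_neq0 y x : polar y x != 0.
Proof.
apply/eqP => e; have := polarD y (- y) x (- x); rewrite !subrr polar00 e mul0r => /eqP.
by rewrite oner_eq0.
Qed.

Lemma polarN y x : polar (- y) (- x) * polar y x = 1.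
Proof. by rewrite -polarD !addNr polar00. Qed.

Lemma polar_int (m : int) : polar 0 m%:~R = 1.
Proof.
have p1 : polar 0 1 = 1.
  rewrite -expi_polar /expi mulr1 mulr_natl -[_ *+ 2]add0r cosD2pi sinD2pi.
  by rewrite cos0 sin0.
have pn (k : nat) : polar 0 k%:R = 1.
  elim: k => [|k IH]; first exact: polar00.
  by rewrite mulrS -(addr0 0) polarD p1 IH mulr1.
case: m => k; first exact: pn.
have := polarN 0 (k.+1%:R); rewrite oppr0 pn mulr1 => <-.
by rewrite NegzE mulrNz.
Qed.

(** For the fractional part t, cos(2 pi t) = 1 forces sin(pi t) = 0, while sin is positive strictly
    between 0 and pi. *)
Lemma polar_eq1 x : polar 0 x = 1 -> exists m : int, x = m%:~R.
Proof.
set t := x - (Num.floor x)%:~R => px.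
have pt : polar 0 t = 1.
  rewrite /t -[X in polar X _](addr0 0) polarD px mul1r -mulrNz.
  exact: polar_int.
have t0 : 0 <= t by rewrite subr_ge0 floor_le_tmp.
have t1 : t < 1 by have := lt_succ_floor x; rewrite intrD /t; lra.
have : cos (2 * pi * t) = 1.
  by move: pt => /eqP; rewrite -expi_polar eq_complex => /andP[/eqP].
rewrite (_ : 2 * pi * t = pi * t + pi * t); last by ring.
rewrite cosD => ht; have := cos2Dsin2 (pi * t) => h2.
have /eqP : sin (pi * t) ^+ 2 = 0 by move: ht h2; rewrite -!expr2; lra.
rewrite expf_eq0 /= => /eqP s0.
have [e|tn] := eqVneq t 0.
  by exists (Num.floor x); apply/eqP; rewrite -subr_eq0 -/t e.
suff : 0 < sin (pi * t) by rewrite s0 ltxx.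
have t2 : 0 < t by rewrite lt_neqAle eq_sym tn.
apply: sin_gt0_pi; rewrite mulr_gt0 ?pi_gt0 //=.
by rewrite -[X in _ < X]mulr1 ltr_pM2l ?pi_gt0.
Qed.

Lemma polar_inj y y' x x' : polar y x = polar y' x' ->
  y = y' /\ exists m : int, x - x' = m%:~R.
Proof.
move=> e; have ey : y = y'.
  have nrm (z u : R) : (expR z * cos u) ^+ 2 + (expR z * sin u) ^+ 2 = expR z ^+ 2.
    by rewrite !exprMn -mulrDr cos2Dsin2 mulr1.
  move: (e) => /eqP; rewrite eq_complex /= => /andP[/eqP e1 /eqP e2].
  have := nrm y (2 * pi * x); rewrite e1 e2 nrm => /eqP.
  by rewrite eqrXn2 ?expR_ge0 // => /eqP/expR_inj.
split=> //; apply: polar_eq1; rewrite -(subrr y) polarD e -ey mulrC.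
exact: polarN.
Qed.

Lemma polar_surj (z : R[i]) : z != 0 -> exists y x, z = polar y x.
Proof.
case: z => a b; rewrite eq_complex /= negb_and => nz.
have r2 : 0 < a ^+ 2 + b ^+ 2.
  have := sqr_ge0 a; have := sqr_ge0 b.
  case/orP: nz => nz h1 h2; have : 0 < (if a != 0 then a else b) ^+ 2.
  - by rewrite nz lt_neqAle sqr_ge0 eq_sym expf_eq0 nz.
  - by rewrite nz; lra.
  - by case: ifP => // h; rewrite lt_neqAle sqr_ge0 eq_sym expf_eq0 ?h ?nz.
  - by case: ifP => _; lra.
set r := Num.sqrt (a ^+ 2 + b ^+ 2).
have r0 : 0 < r by rewrite sqrtr_gt0.
have er : r ^+ 2 = a ^+ 2 + b ^+ 2 by rewrite sqr_sqrtr // ltW.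
pose c := a / r; pose d := b / r.
have cd : c ^+ 2 + d ^+ 2 = 1.
  by rewrite !expr_div_n -mulrDl -er divff // expf_neq0 // gt_eqF.
have c1 : -1 <= c <= 1.
  by rewrite -ler_norml -(expr_le1 (n := 2)) // real_normK ?num_real // -cd lerDl sqr_ge0.
pose th := if 0 <= d then acos c else - acos c.
have cth : cos th = c by rewrite /th; case: ifP => _; rewrite ?cosN acosK // in_itv.
have sth : sin th = d.
  have e : 1 - c ^+ 2 = d ^+ 2 by rewrite -cd addrAC subrr add0r.
  rewrite /th; case: ifP => d0; rewrite ?sinN sin_acos // e sqrtr_sqr.
    by rewrite ger0_norm.
  by rewrite ltr0_norm ?opprK // ltNge d0.
exists (ln r), (th / (2 * pi)); rewrite /polar lnK ?posrE //.
have p0 : 2 * pi != 0 :> R by rewrite mulf_neq0 ?pnatr_eq0 // gt_eqF ?pi_gt0.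
rewrite (mulrC _ (th / _)) divfK // cth sth /c /d.
by rewrite !(mulrC r) !divfK // gt_eqF.
Qed.

End Polar.

(** * The average over the Weyl group and psi_G *)

Section Average.
Variable R : realType.
Variables (n l : nat) (roots : seq 'cV[int]_n) (coroot : 'cV[int]_n -> 'cV[int]_n).
Variable simple : 'I_l -> 'cV[int]_n.
Hypothesis hRD : root_datum_hyp roots coroot simple.
Implicit Types (al be lam mu t nu : 'cV[int]_n) (w M N : 'M[int]_n) (x y v : 'cV[R]_n).

Local Notation s al := (refl al (coroot al)).
Local Notation W := (weyl roots coroot).
Local Notation pos := (posroot roots simple).
Local Notation ir := (map_mx (intr : int -> R)).
Local Notation C := (@alcove R n l roots simple).
Local Notation rcow := (@rcow R n).

Lemma coord_comb t : (forall k : 'I_n, (l <= k)%N -> t k 0 = 0) ->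
  t = \sum_i t (wid hRD i) 0 *: coroot (simple i).
Proof.
move=> t0; apply: pairZ_extr => lam; rewrite pairZ_sumr {1}/pairZ.
have e : \sum_i pairZ lam (t (wid hRD i) 0 *: coroot (simple i)) =
    \sum_(i < l) lam (wid hRD i) 0 * t (wid hRD i) 0.
  by apply: eq_bigr => i _; rewrite pairZZr (pair_simple_coroot hRD) mulrC.
rewrite {}e (bigID (fun k : 'I_n => (k < l)%N)) /= [X in _ + X]big1 => [|k kl]; last first.
  by rewrite t0 ?mulr0 // leqNgt.
rewrite addr0; have ln : (l <= n)%N.
  case: (posnP l) => [->//|l0]; have h : (l.-1 < l)%N by rewrite prednK.
  by rewrite -(prednK l0); apply: (l_le_n hRD (Ordinal h)).
rewrite (big_ord_narrow ln) /=; apply: eq_bigr => i _.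
by rewrite (_ : widen_ord ln i = wid hRD i) //; apply: val_inj.
Qed.

Lemma regular_alcove v al (m : int) : C v -> al \in roots -> pairR al v != m%:~R.
Proof.
move=> Cv ha; apply/eqP => e; have [pa|pa] := pos_or_neg hRD ha.
  have := alcove_pos hRD Cv pa; rewrite e => h.
  have : m%:~R < 1%:~R :> R by lra.
  have : 0%:~R < m%:~R :> R by lra.
  rewrite !ltr_int; lia.
have := alcove_neg hRD Cv pa; rewrite e => h.
have : m%:~R < 0%:~R :> R by lra.
have : (-1)%:~R < m%:~R :> R by lra.
rewrite !ltr_int; lia.
Qed.

(* The vector p is in a_G: y is fixed by (h, t) modulo a_G. *)
Lemma psiG_conj h t y p nu : W h ->
  (forall al, al \in roots -> forall m : int, pairR al y != m%:~R) ->
  (forall al, al \in roots -> pairR al p = 0) ->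
  (forall k : 'I_n, (l <= k)%N -> t k 0 = nu k 0) ->
  rcow h *m y + ir t = y + p ->
  exists w, is_psiG R roots coroot simple nu w /\ weyl_conj roots coroot h w.
Proof.
move=> Wh reg p0 ht e.
have [u [t0 [Wu ht0 Cu]]] := regular_reaches hRD reg.
have Wi := weyl_inv hRD Wu.
pose g := u *m h *m invmx u; have Wg : W g by do 2?apply: weyl_mul => //.
exists g; split; last first.
  exists (invmx u); split=> //; rewrite /g !mulmxA mulVmx ?(weyl_unit hRD) //.
  by rewrite mul1mx.
(* (g, T) is the conjugate of (h, t) by (u, t0), which brings y to the point y1 of the alcove. In
   the coordinates from l on, W acts trivially and the two terms from t0 cancel. *)
pose T := cow u *m t + t0 - cow g *m t0.
have hT (k : 'I_n) : (l <= k)%N -> T k 0 = nu k 0.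
  move=> lk; rewrite mxE [X in X + _]mxE [X in _ + X]mxE !(cow_coord hRD) //.
  by rewrite ht // addrK.
set y1 := rcow u *m y + ir t0 in Cu.
have e1 : rcow g *m y1 + ir T = y1 + p.
  have gu : rcow g *m (rcow u *m y) = rcow u *m (rcow h *m y).
    rewrite !mulmxA -!(rcowM _ hRD) // /g -!mulmxA mulVmx ?mulmx1 //.
    exact: (weyl_unit hRD).
  rewrite /y1 mulmxDr gu /T map_mxD map_mxN map_mxD -!rcow_int.
  have -> : rcow u *m y + ir t0 + p = rcow u *m (y + p) + ir t0.
    by rewrite mulmxDr (rcow_fix hRD _ p0) // addrAC.
  rewrite -e mulmxDr; apply/matrixP => i j; rewrite !mxE; ring.
have Cg : C (rcow g *m y1 + ir T).
  apply: (alcove_eq hRD Cu) => al ha; rewrite e1 pairRDr p0 // addr0 //.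
split=> //; exists (fun i => (T - nu) (wid hRD i) 0) => /=.
rewrite -coord_comb => [|k lk]; last by rewrite mxE hT // mxE subrr.
rewrite subrKC (dualRE _ hRD) //.
exact: (alcove_stab hRD Wg Cu Cg).
Qed.

Lemma weyl_torsion w : W w -> exists2 m, (0 < m)%N & iter m (mulmx w) 1%:M = 1%:M.
Proof.
move=> Ww; have [Ws [uW mW]] := weyl_enum hRD.
pose f k := iter k (mulmx w) 1%:M.
have Wf k : W (f k) by elim: k => [|k IH]; [exact: weyl1 | exact: weyl_mul].
have fD i j : f (i + j)%N = f i *m f j.
  by elim: i => [|i IH]; rewrite ?mul1mx // addSn /= -mulmxA; congr (_ *m _).
have : ~~ uniq (map f (iota 0 (size Ws).+1)).
  apply/negP => u; have : (size (map f (iota 0 (size Ws).+1)) <= size Ws)%N.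
    by apply: uniq_leq_size u _ => _ /mapP[k _ ->]; apply/mW.
  by rewrite size_map size_iota ltnn.
move=> nu; have [i [j [ij e]]] : exists i j, (i < j)%N /\ f i = f j.
  apply: contrapT => nex; move/negP: nu; apply; rewrite map_inj_uniq ?iota_uniq // => i j e.
  by case: (ltngtP i j) => // ij; exfalso; apply: nex; [exists i, j | exists j, i].
exists (j - i)%N; first by rewrite subn_gt0.
have := fD i (j - i)%N; rewrite subnKC ?(ltnW ij) // -e => /(congr1 (mulmx (invmx (f i)))).
by rewrite mulKmx ?(weyl_unit hRD) // mulVmx ?(weyl_unit hRD).
Qed.

Lemma sum_unit_interval (f : nat -> R) m : (0 < m)%N -> (forall k, 0 < f k < 1) ->
  0 < \sum_(k < m) f k < m%:R.
Proof.
case: m => // m _ hf; elim: m => [|m IH]; first by rewrite big_ord1.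
by have := hf m.+1; rewrite big_ord_recr /= [m.+2%:R]mulrS; move: IH; lra.
Qed.

(** * The average over W, that is p_G on real points *)

Variable Ws : seq 'M[int]_n.
Hypothesis uW : uniq Ws.
Hypothesis mW : forall M, M \in Ws <-> W M.

Definition avg x : 'cV[R]_n := (size Ws)%:R^-1 *: \sum_(M <- Ws) rcow M *m x.

Lemma avgD x y : avg (x + y) = avg x + avg y.
Proof.
rewrite /avg -scalerDr -big_split; congr (_ *: _).
by apply: eq_bigr => M _; rewrite mulmxDr.
Qed.

Lemma avgZ c x : avg (c *: x) = c *: avg x.
Proof.
rewrite /avg [RHS]scalerA [c * _]mulrC -[RHS]scalerA; congr (_ *: _); rewrite scaler_sumr.
by apply: eq_bigr => M _; rewrite scalemxAr.
Qed.

Lemma avg0 : avg 0 = 0.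
Proof. by rewrite /avg big1 ?scaler0 // => M _; rewrite mulmx0. Qed.

Lemma avg_rcow w x : W w -> avg (rcow w *m x) = avg x.
Proof.
move=> Ww; rewrite /avg -[in RHS](perm_big _ (perm_weyl_r hRD uW mW Ww)) big_map.
congr (_ *: _); apply: eq_big_seq => M /mW WM.
by rewrite mulmxA (rcowM _ hRD).
Qed.

Lemma rcow_avg w x : W w -> rcow w *m avg x = avg x.
Proof.
move=> Ww; rewrite /avg -[in RHS](perm_big _ (perm_weyl_l hRD uW mW Ww)) big_map.
rewrite -scalemxAr mulmx_sumr; congr (_ *: _); apply: eq_big_seq => M /mW WM.
by rewrite mulmxA (rcowM _ hRD).
Qed.

Lemma size_Ws_neq0 : (size Ws)%:R != 0 :> R.
Proof. by rewrite pnatr_eq0 -lt0n (Ws_gt0 mW). Qed.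

Lemma avg_fix x : (forall al, al \in roots -> pairR al x = 0) -> avg x = x.
Proof.
move=> hx; rewrite /avg (eq_big_seq (fun=> x)) => [|M /mW WM]; last first.
  exact: (rcow_fix hRD).
rewrite big_const_seq count_predT iter_addr_0 -scaler_nat scalerA mulVf ?scale1r //.
exact: size_Ws_neq0.
Qed.

Lemma pairR_avg al x : al \in roots -> pairR al (avg x) = 0.
Proof.
move=> ha; have := rcow_avg x (weyl_refl coroot ha); rewrite (rcow_refl hRD) //.
move=> /(congr1 (pairR al)); rewrite pairRBr pairRZr pairR_int (pair_coroot hRD) //.
lra.
Qed.

Lemma avg_coord x (k : 'I_n) : (l <= k)%N -> avg x k 0 = x k 0.
Proof.
move=> lk; rewrite mxE summxE (eq_big_seq (fun=> x k 0)) => [|M /mW WM]; last first.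
  exact: (rcow_coord hRD).
rewrite big_const_seq count_predT iter_addr_0 -[x k 0 *+ _]mulr_natl mulrA mulVf ?mul1r //.
exact: size_Ws_neq0.
Qed.

(** A simple coroot is negated by its own reflection, so its average is its own opposite. Hence
    p_G(nu) depends only on the class of nu. *)
Lemma avg_coord0 t : (forall k : 'I_n, (l <= k)%N -> t k 0 = 0) -> avg (ir t) = 0.
Proof.
move=> t0; have -> : avg (ir t) = \sum_i (t (wid hRD i) 0)%:~R *: avg (ir (coroot (simple i))).
  have -> : ir t = \sum_i (t (wid hRD i) 0)%:~R *: ir (coroot (simple i)).
    by rewrite {1}(coord_comb t0) raddf_sum; apply: eq_bigr => i _ /=; rewrite map_mxZ.
  by rewrite (big_morph avg avgD avg0); apply: eq_bigr => i _; rewrite avgZ.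
rewrite big1 // => i _; have hi := simple_root hRD i.
have := avg_rcow (ir (coroot (simple i))) (weyl_refl coroot hi).
rewrite (rcow_refl hRD) // pairR_int (pair_coroot hRD) //.
rewrite -[X in X - _]scale1r -scalerBl avgZ => /eqP.
rewrite -subr_eq0 -[X in _ - X]scale1r -scalerBl scaler_eq0 => /orP[/eqP|/eqP->]; last first.
  by rewrite scaler0.
by move=> h; exfalso; move: h; lra.
Qed.

Lemma avg_congr t t' : (forall k : 'I_n, (l <= k)%N -> t k 0 = t' k 0) ->
  avg (ir t) = avg (ir t').
Proof.
move=> e; apply/eqP; rewrite -subr_eq0 -scaleN1r -avgZ -avgD scaleN1r -map_mxN -map_mxD.
by rewrite avg_coord0 // => k lk; rewrite !mxE e // subrr.
Qed.

Lemma pG_avg nu : map_mx (ratr : rat -> R) (pG roots coroot nu) = avg (ir nu).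
Proof.
have eW : W = [set` Ws] by apply/seteqP; split=> M /mW.
rewrite /pG !eW -!fsbig_seq // big_const_seq count_predT iter_addr_0 map_mxZ fmorphV rmorph_nat.
rewrite /avg raddf_sum; congr (_ *: _); apply: eq_big_seq => M /mW WM.
rewrite /dualQ (dual_cow hRD) //.
have -> : map_mx (fun z : int => z%:~R : rat) nu = map_mx (intr : int -> rat) nu by [].
rewrite -map_mxM rcow_int; apply/matrixP => i j; rewrite !mxE; exact: ratr_int.
Qed.

Lemma ratr_pairQ lam (p : 'cV[rat]_n) :
  ratr (pairQ lam p) = pairR lam (map_mx (ratr : rat -> R) p).
Proof.
by rewrite rmorph_sum; apply: eq_bigr => k _; rewrite mxE rmorphM /= ratr_int.
Qed.

Lemma pairQ_pG al nu : al \in roots -> pairQ al (pG roots coroot nu) = 0.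
Proof.
move=> ha; have /eqP : ratr (pairQ al (pG roots coroot nu)) = 0 :> R.
  by rewrite ratr_pairQ pG_avg pairR_avg.
by rewrite fmorph_eq0 => /eqP.
Qed.

Lemma pairQ_pG_weyl w lam nu : W w ->
  pairQ (w *m lam) (pG roots coroot nu) = pairQ lam (pG roots coroot nu).
Proof.
move=> Ww; apply: (fmorph_inj (@ratr R)) => /=; rewrite !ratr_pairQ pG_avg.
by rewrite -{1}(rcow_avg (ir nu) Ww) (pairR_rcow hRD).
Qed.

(** A W-invariant vector is orthogonal to every root; the condition on Omega therefore reads val
    Omega = 0. *)
Lemma m_nu0 nu : m_nu roots coroot nu = 0.
Proof.
by rewrite /m_nu big_seq big1 // => al ha; rewrite pairQ_pG // maxxx.
Qed.

Lemma alcove_fixpoint nu : exists w (T : 'cV[int]_n) x, [/\ W w, C x,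
  forall k : 'I_n, (l <= k)%N -> T k 0 = nu k 0 &
  rcow w *m x + ir T = x + avg (ir nu)].
Proof.
have [y0 Cy0] := alcove_nonempty R hRD.
(* Translating the alcove point y0 by nu gives a regular point. The affine Weyl element that brings
   it back, composed with the translation, is a map G in the class of nu that sends y0 into the
   alcove, and so preserves the alcove. *)
have [|w [t [Ww t0 Cw]]] := regular_reaches hRD (y := y0 + ir nu).
  move=> al ha m; rewrite pairRDr pairR_int; apply/eqP => e.
  by have := regular_alcove (m - pairZ al nu) Cy0 ha; rewrite intrB -e addrK eqxx.
pose T := cow w *m nu + t.
have hT (k : 'I_n) : (l <= k)%N -> T k 0 = nu k 0.
  by move=> lk; rewrite mxE (cow_coord hRD) // t0 // addr0.
pose G x : 'cV[R]_n := rcow w *m x + ir T.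
have CG : C (G y0) by move: Cw; rewrite mulmxDr rcow_int -addrA -map_mxD.
have Ck k : C (iter k G y0).
  by elim: k => [//|k IH] /=; apply: (alcove_stab_sub hRD Ww Cy0 CG IH).
have [m m0 wm] := weyl_torsion Ww.
have Gk k : exists t', forall x, iter k G x = rcow (iter k (mulmx w) 1%:M) *m x + ir t'.
  elim: k => [|k [t' IH]].
    by exists 0 => x; rewrite map_mx0 addr0 rcow1 mul1mx.
  have Wk : W (iter k (mulmx w) 1%:M).
    by elim: k {IH} => [|k IH]; [exact: weyl1 | exact: weyl_mul].
  exists (cow w *m t' + T) => x; rewrite /= IH /G mulmxDr rcow_int mulmxA.
  by rewrite (rcowM _ hRD) // [in RHS]map_mxD [in RHS]addrA.
have [t' ht'] := Gk m; rewrite wm in ht'.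
have Gm : iter m G y0 = y0 + ir t' by rewrite ht' rcow1 mul1mx.
(* The power of G with trivial linear part is the translation by t'. It takes y0 to a point of the
   alcove, so <be, t'> is an integer strictly between -1 and 1: G has finite order only modulo
   a_G. *)
have z0 al : al \in roots -> pairZ al t' = 0.
  have ps be : pos be -> pairZ be t' = 0.
    move=> pb; have := alcove_pos hRD (Ck m) pb; have := alcove_pos hRD Cy0 pb.
    rewrite Gm pairRDr pairR_int => h1 h2.
    have : (-1)%:~R < (pairZ be t')%:~R :> R by lra.
    have : (pairZ be t')%:~R < 1%:~R :> R by lra.
    rewrite !ltr_int; lia.
  move=> ha; have [/ps//|/ps] := pos_or_neg hRD ha.
  by rewrite pairZNl => /eqP; rewrite oppr_eq0 => /eqP.
have mR : m%:R != 0 :> R by rewrite pnatr_eq0 -lt0n.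
pose x := m%:R^-1 *: \sum_(k < m) iter k G y0.
pose z := m%:R^-1 *: ir t'.
have ez : rcow w *m x + ir T = x + z.
  rewrite /x -scalemxAr mulmx_sumr -scalerDr.
  have -> : ir T = m%:R^-1 *: \sum_(k < m) ir T.
    by rewrite sumr_const card_ord -scaler_nat scalerA mulVf // scale1r.
  rewrite -scalerDr -big_split /=; congr (_ *: _).
  have -> : ir t' = iter m G y0 - y0 by rewrite Gm addrC addKr.
  have e : y0 + \sum_(k < m) iter k.+1 G y0 = \sum_(k < m) iter k G y0 + iter m G y0.
    transitivity (\sum_(k < m.+1) iter k G y0); first by rewrite big_ord_recl.
    by rewrite big_ord_recr.
  by rewrite addrA -e addrC addKr.
exists w, T, x; split=> //.
  apply: (alcoveP hRD) => al pa; rewrite pairRZr pairR_sumr.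
  have := sum_unit_interval (f := fun k => pairR al (iter k G y0)) m0.
  move=> /(_ (fun k => alcove_pos hRD (Ck k) pa))/andP[h1 h2].
  by rewrite mulr_gt0 ?invr_gt0 ?ltr0n //= mulrC ltr_pdivrMr ?ltr0n // mul1r.
rewrite ez; congr (_ + _).
(* Averaging the relation [ez] removes w and turns T into nu, which identifies z with p_G(nu). *)
have az : avg z = z.
  by apply: avg_fix => al ha; rewrite pairRZr pairR_int z0 // mulr0.
have := congr1 avg ez; rewrite !avgD avg_rcow // az (avg_congr hT).
by move=> /addrI.
Qed.

End Average.

(** * Torus points over the Puiseux series *)

Section PairQ.
Variable n : nat.
Implicit Types (lam mu : 'cV[int]_n) (p : 'cV[rat]_n).

Lemma pairQDl lam mu p : pairQ (lam + mu) p = pairQ lam p + pairQ mu p.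
Proof. by rewrite /pairQ -big_split; apply: eq_bigr => k _; rewrite mxE intrD mulrDl. Qed.

Lemma pairQ0l p : pairQ 0 p = 0.
Proof. by rewrite /pairQ big1 // => k _; rewrite mxE mul0r. Qed.

End PairQ.

Section TorusPoints.
Variable R : realType.
Variable n : nat.
Implicit Types (lam mu : 'cV[int]_n).

Definition torus_lift a (ha : is_torus_pt a) : 'cV[int]_n -> puiseux R :=
  fun lam => mkpuis (ha.1 lam).

Lemma torus_lift_character a (ha : is_torus_pt a) : character (torus_lift ha).
Proof.
have [_ [_ [a0 aM]]] := ha.
by split=> [|lam mu]; apply/val_inj; [exact: a0 | exact: aM].
Qed.

Lemma pval_sum (I : Type) (r : seq I) (F : I -> puiseux R) q :
  pval (\sum_(i <- r) F i) q = \sum_(i <- r) pval (F i) q.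
Proof. exact: (big_morph (fun x : puiseux R => pval x q)). Qed.

Lemma Omega_prod (roots : seq 'cV[int]_n) (A : 'cV[int]_n -> puiseux R) :
  Omega roots (fun lam => pval (A lam)) = pval (\prod_(al <- roots) (1 - A al)).
Proof. by elim: roots => [|al r IH]; rewrite ?big_nil // big_cons /= IH. Qed.

Lemma character_polar (t : 'cV[int]_n -> R[i]) :
  t 0 = 1 -> (forall lam mu, t (lam + mu) = t lam * t mu) ->
  exists y x : 'cV[R]_n, forall lam, t lam = polar (pairR lam y) (pairR lam x).
Proof.
move=> t0 tM.
have tN lam : t lam * t (- lam) = 1 by rewrite -tM subrr.
have tn0 lam : t lam != 0.
  by apply/eqP => e; have := tN lam; rewrite e mul0r => /eqP; rewrite eq_sym oner_eq0.
have ex (k : 'I_n) : exists yx : R * R, t (evec n k) = polar yx.1 yx.2.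
  by have [y [x e]] := polar_surj (tn0 (evec n k)); exists (y, x).
have [f hf] := choice ex.
exists (\col_k (f k).1), (\col_k (f k).2) => lam.
apply: (int_span (P := fun mu => t mu = polar (pairR mu _) (pairR mu _))).
- by rewrite t0 !pairR0l polar00.
- move=> mu nu emu enu; apply: (mulIf (tn0 nu)); rewrite -tM subrK emu enu -polarD.
  by rewrite !pairRBl !subrK.
- by move=> k _; rewrite hf !pairR_evec !mxE.
Qed.

End TorusPoints.

Section PsiG.
Variable R : realType.
Variables (n l : nat) (roots : seq 'cV[int]_n) (coroot : 'cV[int]_n -> 'cV[int]_n).
Variable simple : 'I_l -> 'cV[int]_n.
Hypothesis hRD : root_datum_hyp roots coroot simple.
Implicit Types (al be lam mu t nu : 'cV[int]_n) (w M N h : 'M[int]_n) (x y v : 'cV[R]_n).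
Implicit Types a b : 'cV[int]_n -> puis R.

Local Notation s al := (refl al (coroot al)).
Local Notation W := (weyl roots coroot).
Local Notation ir := (map_mx (intr : int -> R)).
Local Notation C := (@alcove R n l roots simple).
Local Notation rcow := (@rcow R n).
Local Notation pG := (pG roots coroot).

Variable Ws : seq 'M[int]_n.
Hypothesis uW : uniq Ws.
Hypothesis mW : forall M, M \in Ws <-> W M.

Lemma weyl_mulI M : W M -> injective (mulmx M : 'cV_n -> 'cV_n).
Proof. by move=> /(weyl_unit hRD) uM x y e; rewrite -[x](mulKmx uM) e mulKmx. Qed.

(** [cmap] counts each element of the orbit O once, [orbsum] once for each element of W. Counting
    over O and W together gives |O| times the one as |W| times the other, and |O| is cancelled. *)
Lemma cmap_orbsum a b (ha : is_torus_pt a) (hb : is_torus_pt b) :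
  cmap roots coroot a = cmap roots coroot b ->
  forall k : 'I_n, orbsum Ws (torus_lift ha) (evec n k) = orbsum Ws (torus_lift hb) (evec n k).
Proof.
move=> eab k; pose O := undup [seq M *m evec n k | M <- Ws].
have uO : uniq O by apply: undup_uniq.
have memO lam : reflect (exists2 M, W M & lam = M *m evec n k) (lam \in O).
  rewrite mem_undup; apply: (iffP mapP) => [[M /mW WM ->]|[M /mW WM ->]]; by exists M.
have orbE c q : cmap roots coroot c k q = \sum_(lam <- O) c lam q.
  rewrite (fsbig_seq _ _ uO) /cmap; have -> // : [set M *m evec n k | M in W] = [set` O].
  by apply/seteqP; split=> [_ [M WM <-]|_ /memO[M WM ->]]; [apply/memO|]; exists M.
have sumO A : character A ->
    orbsum Ws A (evec n k) *+ size O = (\sum_(lam <- O) A lam) *+ size Ws :> puiseux R.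
  move=> cA; transitivity (\sum_(lam <- O) \sum_(M <- Ws) A (M *m lam)).
    rewrite (eq_big_seq (fun=> orbsum Ws A (evec n k))) => [|lam /memO[M WM ->]].
      by rewrite big_const_seq count_predT iter_addr_0.
    exact: (orbsum_weyl hRD uW mW).
  rewrite exchange_big (eq_big_seq (fun=> \sum_(lam <- O) A lam)) => [|M /mW WM] /=.
    by rewrite big_const_seq count_predT iter_addr_0.
  have pO : perm_eq (map (mulmx M) O) O.
    apply: map_perm_self => //; first exact: weyl_mulI.
    by move=> _ /memO[N WN ->]; apply/memO; exists (M *m N); rewrite ?mulmxA //; apply: weyl_mul.
  by rewrite -[RHS](perm_big _ pO) big_map.
have O0 : (0 < size O)%N.
  have : evec n k \in O by apply/memO; exists 1%:M; rewrite ?mul1mx //; apply: weyl1.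
  by case: (O).
apply: (mulrn_inj (@puiseux_dom R) (@puiseux_char0 R) O0).
rewrite !sumO; try exact: torus_lift_character.
congr (_ *+ _); apply/val_inj/funext => q; rewrite /= !pval_sum /=.
by rewrite -!orbE eab.
Qed.

Lemma cmap_weyl a b : is_torus_pt a -> is_torus_pt b ->
  cmap roots coroot a = cmap roots coroot b ->
  exists2 M, W M & forall lam, b lam = a (M *m lam).
Proof.
move=> ha hb e; have [M WM h] := weyl_separation hRD (@puiseux_dom R) (@puiseux_char0 R) uW mW
  (torus_lift_character ha) (torus_lift_character hb) (cmap_orbsum ha hb e).
by exists M => // lam; have := congr1 (@pval R) (h lam).
Qed.

Lemma Omega_weyl a b M : is_torus_pt a -> W M -> (forall lam, b lam = a (M *m lam)) ->
  Omega roots b = Omega roots a.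
Proof.
move=> ha WM e; have -> : b = fun lam => pval (torus_lift ha (M *m lam)) by apply/funext.
have {2}-> : a = fun lam => pval (torus_lift ha lam) by [].
rewrite !Omega_prod; congr pval.
have pM : perm_eq (map (mulmx M) roots) roots.
  apply: map_perm_self (weyl_mulI WM) _; first exact: (roots_uniq hRD).
  by move=> al; apply: (weyl_root hRD).
by rewrite -[RHS](perm_big _ pM) big_map.
Qed.

(** Along the line, a root value is either constant, and then not an integer, or it varies and
    avoids Z for all small e > 0. There are finitely many roots, so one e serves them all. *)
Lemma generic_combination x y (r : seq 'cV[int]_n) :
  (forall al, al \in r -> pairR al y = 0 -> forall m : int, pairR al x != m%:~R) ->
  exists e : R, forall al, al \in r -> forall m : int, pairR al (x + e *: y) != m%:~R.
Proof.
move=> hr.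
have [d d0 hd] : exists2 d : R, 0 < d & forall al, al \in r ->
    forall e, 0 < e <= d -> forall m : int, pairR al (x + e *: y) != m%:~R.
  apply: exists_small => [al ar|al d d' /andP[_ dd] h e /andP[e0 ed] m]; last first.
    by apply: h; rewrite e0 (le_trans ed).
  set c := pairR al y; set b := pairR al x.
  have E e : pairR al (x + e *: y) = b + e * c by rewrite pairRDr pairRZr.
  have [c0|c0] := eqVneq c 0.
    by exists 1 => // e _ m; rewrite E c0 mulr0 addr0; apply: hr.
  have cp : 0 < `|c| by rewrite normr_gt0.
  have bound f e : 0 < e <= f / (2 * `|c|) -> 0 < f -> `|e * c| < f.
    move=> /andP[e0]; rewrite ler_pdivlMr ?mulr_gt0 // => h f0.
    by rewrite normrM (gtr0_norm e0); lra.
  (* For b in Z, a nonzero e * c of absolute value below 1 suffices; otherwise it must stay below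
     the distance from b to Z. The factor 2 makes these bounds strict. *)
  have [[m0 bm]|nb] := pselect (exists m0 : int, b = m0%:~R).
    exists (1 / (2 * `|c|)) => [|e he m]; first by rewrite divr_gt0 // mulr_gt0.
    have := bound 1 e he ltr01; have /andP[e0 _] := he => h.
    rewrite E bm; apply/eqP => em.
    have ec : e * c = (m - m0)%:~R by rewrite intrB -em addrC addKr.
    move: h; rewrite ec -intr_norm -[X in _ < X]/(1%:~R) ltr_int => h.
    have m00 : m - m0 = 0 by lia.
    move: ec => /eqP; rewrite m00 mulf_eq0 (negbTE c0) orbF gt_eqF //.
  have [|f f0 hf] := @dist_int_gt0 R b.
    by move=> m; apply/eqP => e; apply: nb; exists m.
  exists (f / (2 * `|c|)) => [|e he m]; first by rewrite divr_gt0 // mulr_gt0.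
  have := bound f e he f0; have := hf m; rewrite E => h1 h2; apply/eqP => em.
  move: h1; rewrite -em opprD addrA subrr add0r normrN; lra.
by exists d => al ar m; apply: hd; rewrite // d0 lexx.
Qed.

(* Leading coefficients turn a into a point of the complex torus; its argument,
   perturbed along its log-modulus, is a regular point of the apartment that h
   fixes up to a translation. *)
Lemma torus_pt_psiG a nu h : is_torus_pt a ->
  (forall lam, has_val (a lam) (pairQ lam (pG nu))) ->
  has_val (Omega roots a) 0 -> W h -> tsigma a = tweyl h a ->
  exists w, is_psiG R roots coroot simple nu w /\ weyl_conj roots coroot h w.
Proof.
move=> ha hval hOm Wh hsig; have [_ [_ [a0 aM]]] := ha.
set p := pG nu in hval; pose pr := avg Ws (ir nu).
have epr : map_mx (ratr : rat -> R) p = pr by apply: (pG_avg R hRD uW mW).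
have Wi := weyl_inv hRD Wh.
pose t lam := a lam (- pairQ lam p).
have supp lam q : a lam q != 0 -> - pairQ lam p <= q by have [_] := hval lam; apply.
have t0 : t 0 = 1 by rewrite /t a0 pairQ0l oppr0 /pone eqxx.
have tM lam mu : t (lam + mu) = t lam * t mu.
  rewrite /t aM pairQDl opprD.
  by have [-> _] := pmul_lead (supp lam) (supp mu).
have [y [x tE]] := character_polar t0 tM.
(* Compare sigma(a) = h(a) at the exponent - <lam, p>, the lowest on both sides because p is
   W-fixed. The factor from sigma has modulus 1 and argument - <lam, p>, so the moduli agree and the
   arguments agree modulo Z after this shift. *)
have key lam : pairR lam y = pairR (invmx h *m lam) y /\
    exists m : int, pairR lam x - pairR lam pr - pairR (invmx h *m lam) x = m%:~R.
  have := congr1 (fun b => b lam (- pairQ lam p)) hsig.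
  rewrite /tsigma /tweyl /psigma expi_polar -/(t lam) rmorphN /= ratr_pairQ epr.
  rewrite -(pairQ_pG_weyl R hRD uW mW lam nu Wi) -/p -/(t (invmx h *m lam)) !tE.
  rewrite -polarD add0r => /polar_inj[-> [m em]]; split=> //; exists m.
  by rewrite -em; lra.
have hy : rcow h *m y = y.
  by apply: pairR_extr => lam; rewrite (pairR_rcowV hRD) // -(key lam).1.
have ex (k : 'I_n) : exists m : int, pairR (evec n k) (x - pr - rcow h *m x) = m%:~R.
  by rewrite !pairRBr (pairR_rcowV hRD) //; apply: (key _).2.
have [f hf] := choice ex; pose m : 'cV[int]_n := \col_k f k.
have hx : x - pr - rcow h *m x = ir m.
  by apply/matrixP => k j; rewrite ord1 -pairR_evec hf !mxE.
(* A root with log-modulus 0 and integral argument would have leading coefficient 1; its factor 1 -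
   a(al) would have no constant term, against val Omega = 0. *)
have reg al : al \in roots -> pairR al y = 0 -> forall k : int, pairR al x != k%:~R.
  move=> ar y0 k; apply/eqP => xk.
  have al0 : pairQ al p = 0 by apply: (pairQ_pG R hRD uW mW).
  have ta : a al 0 = 1.
    by have := tE al; rewrite /t al0 oppr0 y0 xk polar_int.
  have [+ _] := hOm; rewrite oppr0.
  have -> : a = fun lam => pval (torus_lift ha lam) by [].
  rewrite Omega_prod; have [|-> _] := @pval_prod_lead R _ roots (fun al => 1 - torus_lift ha al).
    move=> be hb q /=; rewrite /pone; have [->|q0] := eqVneq q 0; first by [].
    rewrite add0r oppr_eq0 => /supp; rewrite /p (pairQ_pG R hRD uW mW) //.
  rewrite prodf_seq_neq0 => /allP/(_ al ar) /=.
  by rewrite ta /pone eqxx subrr eqxx.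
have [e he] := generic_combination reg.
pose X := x + e *: y.
(* The sign is changed because val is minus the order in eps: for X itself the vector of a_G would
   be - p_G(nu), giving the opposite class. The multiple of y drops out since h fixes y. *)
have hX : rcow h *m (- X) + ir (- m) = - X + pr.
  rewrite map_mxN -hx /X mulmxN mulmxDr -scalemxAr hy.
  by apply/matrixP => i j; rewrite !mxE; ring.
apply: (psiG_conj hRD Wh _ _ _ hX) => [al ar k|al ar|k lk].
- by have := he al ar (- k); rewrite pairRNr mulrNz eqr_oppLR.
- by apply: (pairR_avg hRD uW mW).
(* In the coordinates from l on h acts trivially, so [hX] reads - m = p_G(nu) there, and averaging
   has not changed these coordinates of nu. *)
- apply: (@intr_inj R); have /matrixP/(_ k 0) := hX.
  rewrite mxE [X in _ = X]mxE (rcow_coord hRD) // => /addrI.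
  by rewrite mxE => ->; rewrite /pr (avg_coord hRD mW) // mxE.
Qed.

End PsiG.

(** * Proof of the theorem *)

Section Monomial.
Variable R : realType.
Implicit Types (c : R[i]) (q : rat).

Definition monomial c q : puis R := fun r => if r == q then c else 0.

Lemma monomialP c q r : monomial c q r != 0 -> r = q.
Proof. by rewrite /monomial; have [//|_] := eqVneq r q; rewrite eqxx. Qed.

Lemma monomial_coef c q : monomial c q q = c.
Proof. by rewrite /monomial eqxx. Qed.

Lemma is_puis_monomial c q : is_puis (monomial c q).
Proof.
exists `|denq q|%N; split; first by rewrite absz_gt0 denq_neq0.
exists (numq q) => r /monomialP->; exists (numq q); split=> //.
by rewrite -{1}(divq_num_den q) pmulrn absz_denq.
Qed.

Lemma pmul_monomial c c' q q' :
  pmul (monomial c q) (monomial c' q') = monomial (c * c') (q + q').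
Proof.
apply/funext => r; rewrite (pmulE (s := [:: q])) // => [|u /monomialP->]; last first.
  by rewrite mem_head.
rewrite big_seq1 monomial_coef /monomial subr_eq addrC.
by case: eqP => // _; rewrite mulr0.
Qed.

End Monomial.

Section Nonempty.
Variable R : realType.
Variables (n l : nat) (roots : seq 'cV[int]_n) (coroot : 'cV[int]_n -> 'cV[int]_n).
Variable simple : 'I_l -> 'cV[int]_n.
Hypothesis hRD : root_datum_hyp roots coroot simple.

Lemma X_nu_nonempty (nu : 'cV[int]_n) : exists c : 'I_n -> puis R, X_nu roots coroot nu c.
Proof.
have [Ws [uW mW]] := weyl_enum hRD.
have [w [T [x [Ww Cx hT ex]]]] := alcove_fixpoint R hRD uW mW nu.
set p := pG roots coroot nu.
have ep : map_mx (ratr : rat -> R) p = avg Ws (map_mx intr nu) by apply: (pG_avg R hRD uW mW).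
have Wi := weyl_inv hRD Ww.
(* sigma multiplies the monomial at lam by exp(- 2 i pi <lam, p>). With the argument - x, the
   equation [ex] becomes sigma(a) = w(a); the translation T is invisible as <lam, T> is an
   integer. *)
pose a lam : puis R := monomial (polar 0 (- pairR lam x)) (- pairQ lam p).
have ta : is_torus_pt a.
  split; [|split; [|split]] => [lam|lam||lam mu].
  - exact: is_puis_monomial.
  - apply/eqP => e; have := monomial_coef (polar 0 (- pairR lam x)) (- pairQ lam p).
    by rewrite -/(a lam) e => /esym/eqP; rewrite (negbTE (polar_neq0 _ _)).
  - by rewrite /a pairR0l pairQ0l !oppr0 polar00.
  - by rewrite pmul_monomial -polarD /a pairRDl pairQDl !opprD addr0.
have va lam : has_val (a lam) (pairQ lam p).
  by split=> [|q /monomialP->//]; rewrite /a monomial_coef polar_neq0.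
have sa : tsigma a = tweyl w a.
  apply/funext => lam; apply/funext => q; rewrite /tsigma /psigma /tweyl /a.
  rewrite (pairQ_pG_weyl R hRD uW mW lam nu Wi) -/p -(pairR_rcowV hRD _ _ Ww).
  rewrite /monomial; case: eqP => [->|_]; last by rewrite mulr0.
  rewrite expi_polar rmorphN /= ratr_pairQ ep -polarD addr0.
  have /(congr1 (pairR lam)) := ex; rewrite !pairRDr pairR_int => e.
  rewrite -[LHS]mulr1 -(polar_int R (pairZ lam T)) -polarD addr0; congr polar.
  by lra.
have Om : has_val (Omega roots a) (m_nu roots coroot nu).
  rewrite (m_nu0 R hRD uW mW) /has_val oppr0.
  have -> : a = fun lam => pval (torus_lift ta lam) by [].
  rewrite Omega_prod.
  have [|-> h] := @pval_prod_lead R _ roots (fun al => 1 - torus_lift ta al).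
    move=> be hb q /=; rewrite /pone; have [->//|q0] := eqVneq q 0.
    rewrite add0r oppr_eq0 => /monomialP.
    by rewrite (pairQ_pG R hRD uW mW) // oppr0 => ->.
  split=> //; rewrite prodf_seq_neq0; apply/allP => al ar /=.
  have -> : a al 0 = polar 0 (- pairR al x).
    by rewrite /a (pairQ_pG R hRD uW mW) // oppr0 monomial_coef.
  rewrite /pone eqxx subr_eq0 eq_sym; apply/eqP => /polar_eq1[m em].
  have := regular_alcove hRD (- m) Cx ar.
  by rewrite mulrNz -em opprK eqxx.
exists (cmap roots coroot a); split; exists a; split=> //; split=> //.
by split=> //; exists w.
Qed.

End Nonempty.

Lemma weyl_conj_inv n l (roots : seq 'cV[int]_n) coroot (simple : 'I_l -> 'cV[int]_n)
    (M h w : 'M[int]_n) : root_datum_hyp roots coroot simple ->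
  weyl roots coroot M -> weyl_conj roots coroot (invmx M *m h *m M) w ->
  weyl_conj roots coroot h w.
Proof.
move=> hRD WM [u [Wu e]]; exists (M *m u); split; first exact: weyl_mul.
by rewrite -mulmxA e !mulmxA mulmxV ?mul1mx // (weyl_unit hRD).
Qed.

Theorem theorem2p6 (R : realType) (n l : nat) (roots : seq 'cV[int]_n)
    (coroot : 'cV[int]_n -> 'cV[int]_n) (simple : 'I_l -> 'cV[int]_n)
    (hRD : root_datum_hyp roots coroot simple) (nu : 'cV[int]_n) :
  (exists c : 'I_n -> puis R, X_nu roots coroot nu c) /\
  (forall a : 'cV[int]_n -> puis R, is_torus_pt a ->
     X_nu roots coroot nu (cmap roots coroot a) ->
     forall h : 'M[int]_n, weyl roots coroot h -> tsigma a = tweyl h a ->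
     exists w : 'M[int]_n, is_psiG R roots coroot simple nu w /\
       weyl_conj roots coroot h w).
Proof.
split; first exact: (X_nu_nonempty R hRD).
(* [X_nu] supplies two further points: a1 carries the valuations, a2 the condition on Omega. Both
   have the same image as a under c, so they are conjugates of a, and Omega is W-invariant. *)
move=> a ta [[a1 [ta1 [e1 [_ v1]]]] [a2 [ta2 [e2 Om]]]] h Wh sa.
have [Ws [uW mW]] := weyl_enum hRD.
have [M WM a1E] := cmap_weyl hRD uW mW ta ta1 e1.
have [N WN a2E] := cmap_weyl hRD uW mW ta ta2 e2.
have Om1 : has_val (Omega roots a1) 0.
  by rewrite (Omega_weyl hRD ta WM a1E) -(Omega_weyl hRD ta WN a2E) -(m_nu0 R hRD uW mW nu).
have Wi := weyl_inv hRD WM; have uM := weyl_unit hRD WM; have uh := weyl_unit hRD Wh.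
(* Since a1 is M^-1(a), the Galois generator acts on it as the conjugate M^-1 h M. *)
have Wh1 : weyl roots coroot (invmx M *m h *m M) by do 2?apply: weyl_mul.
have invh : invmx (invmx M *m h *m M) = invmx M *m invmx h *m M.
  rewrite -[LHS]mulmx1; apply: (canLR (mulKmx _)); first exact: (weyl_unit hRD).
  by rewrite -!mulmxA (mulmxA M) mulmxV // mul1mx (mulmxA h) mulmxV // mul1mx mulVmx.
have sa1 : tsigma a1 = tweyl (invmx M *m h *m M) a1.
  apply/funext => lam; have := congr1 (fun b => b (M *m lam)) sa.
  rewrite /tsigma /tweyl invh !a1E => ->.
  by rewrite !mulmxA mulmxV // mul1mx.
have [w [pw cw]] := torus_pt_psiG hRD uW mW ta1 v1 Om1 Wh1 sa1.
by exists w; split=> //; apply: weyl_conj_inv hRD WM cw.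
Qed.
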